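(* Let $P$ be a finite poset with minimum $\hat0$ and maximum $\hat1$, and let $z\in P$ be removable. If $\Delta(\overline{P})$ is a PL $d$-ball or a PL $d$-sphere, then $\Delta(\overline{P}-\{z\})$ is a PL $d$-ball.
   Context: $\overline{P}=P-\{\hat0,\hat1\}$ and $\Delta(\cdot)$ denotes the order complex (simplicial complex of chains). Let $\mathbf{2}=\{\alpha<\beta\}$. An element $z\neq\hat1$ of $P$ is removable if $z$ covers exactly one element $x$, and there exist a coatom $c$ (element covered by $\hat1$) and a poset isomorphism $\varphi:[x,\hat1]\to[x,c]\times\mathbf{2}$ with $\varphi(z)=(x,\beta)$. A PL $d$-ball is a simplicial complex PL homeomorphic to a $d$-simplex; a PL $(d-1)$-sphere is one PL homeomorphic to the boundary complex of a $d$-simplex. *)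

(* Defs.v *)
From HB Require Import structures.
From mathcomp Require Import all_boot all_order all_algebra.
From mathcomp Require Import reals.

Set Implicit Arguments.
Unset Strict Implicit.
Unset Printing Implicit Defensive.

Import Order.TTheory GRing.Theory Num.Theory.

Local Open Scope ring_scope.

(** * Posets *)

Section Posets.
Context {disp : Order.disp_t} {P : finTBPOrderType disp}.
Local Open Scope order_scope.
Implicit Types x y z c : P.

Definition covers y x : bool := (x < y) && [forall w : P, ~~ (x < w < y)].

Definition coatom c : bool := covers \top c.

Definition subinterval x y : Type := {w : P | x <= w <= y}.

HB.instance Definition _ x y := SubChoice.on (subinterval x y).
HB.instance Definition _ x y :=
  [SubChoice_isSubPOrder of subinterval x y by <: with disp].

(* The chain 2 = {alpha < beta} is [bool], with alpha = false, beta = true;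
   [*p] is the type of pairs with the componentwise order. *)
Definition removable z : Prop :=
  z != \top /\
  exists x,
    [/\ covers z x,
        forall y, covers z y -> y = x
      & exists2 c, coatom c &
        exists phi : subinterval x \top -> (subinterval x c *p bool),
          [/\ bijective phi,
              {mono phi : u v / u <= v}
            & exists2 u : subinterval x \top, val u = z &
                val (phi u).1 = x /\ (phi u).2 = true]].

End Posets.

Definition proper_part {disp : Order.disp_t} (P : finTBPOrderType disp) :
  {set P} := ~: [set \bot; \top]%O.

(** * Finite simplicial complexes *)

(* An element of the vertex type need not itself be a vertex of the complex. *)
Record simplicial_complex (V : finType) := SimplicialComplex {
  faces :> {set {set V}};
  faces_closed :
    forall s t : {set V}, t \subset s -> s \in faces -> t \in faces
}.

Section OrderComplex.
Context {disp : Order.disp_t} {P : finPOrderType disp} (A : {set P}).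

Definition chains : {set {set P}} :=
  [set C : {set P} |
    (C \subset A) && [forall u in C, forall v in C, (u >=< v)%O]].

Lemma chains_closed (s t : {set P}) :
  t \subset s -> s \in chains -> t \in chains.
Proof.
move=> /subsetP ts; rewrite !inE => /andP[/subsetP sA /forall_inP cs].
apply/andP; split; first by apply/subsetP => u /ts /sA.
apply/forall_inP => u /ts us; apply/forall_inP => v /ts vs.
by move: (cs u us) => /forall_inP /(_ v vs).
Qed.

Definition order_complex : simplicial_complex P :=
  SimplicialComplex chains_closed.

End OrderComplex.

Lemma simplex_closed (d : nat) (s t : {set 'I_d.+1}) :
  t \subset s -> s \in [set: {set 'I_d.+1}] -> t \in [set: {set 'I_d.+1}].
Proof. by rewrite !inE. Qed.

Definition simplex (d : nat) : simplicial_complex 'I_d.+1 :=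
  SimplicialComplex (@simplex_closed d).

Lemma simplex_boundary_closed (d : nat) (s t : {set 'I_d.+1}) :
  t \subset s -> s \in [set u : {set 'I_d.+1} | u \proper setT] ->
  t \in [set u : {set 'I_d.+1} | u \proper setT].
Proof. by rewrite !inE; apply: sub_proper_trans. Qed.

Definition simplex_boundary (d : nat) : simplicial_complex 'I_d.+1 :=
  SimplicialComplex (@simplex_boundary_closed d).

(** * Piecewise linear topology *)

Section PL.
Variable R : realType.

(* Geometric realization in barycentric coordinates. *)
Definition realization (V : finType) (K : simplicial_complex V)
    (x : {ffun V -> R}) : Prop :=
  [/\ forall v, 0 <= x v, \sum_v x v = 1 & [set v | x v != 0] \in K].

(* A convex polyhedron, presented as a finite system of affine inequalities
   [\sum_v a v * x v <= b], one for each pair [(a, b)]. *)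
Definition polyhedron (V : finType) := seq ({ffun V -> R} * R).

Definition in_polyhedron (V : finType) (C : polyhedron V) (x : {ffun V -> R}) :
  Prop := forall h, h \in C -> \sum_v h.1 v * x v <= h.2.

Definition affine_on (V W : finType) (D : {ffun V -> R} -> Prop)
    (f : {ffun V -> R} -> {ffun W -> R}) : Prop :=
  exists (A : W -> V -> R) (b : W -> R),
    forall x, D x -> forall w, f x w = \sum_v A w v * x v + b w.

(* [f] restricts to a PL map |K| -> |L|: |K| is a finite union of convex
   polyhedra (compact, since |K| is bounded), on each of which [f] is affine.
   Continuity on |K| follows, as the pieces are closed and finite in number.
   The values of [f] outside |K| are irrelevant. *)
Definition PL_map (V W : finType)
    (K : simplicial_complex V) (L : simplicial_complex W)
    (f : {ffun V -> R} -> {ffun W -> R}) : Prop :=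
  (forall x, realization K x -> realization L (f x)) /\
  exists Cs : seq (polyhedron V),
    (forall x, realization K x <-> exists2 C, C \in Cs & in_polyhedron C x) /\
    (forall C, C \in Cs -> affine_on (in_polyhedron C) f).

Definition PL_homeomorphic (V W : finType)
    (K : simplicial_complex V) (L : simplicial_complex W) : Prop :=
  exists (f : {ffun V -> R} -> {ffun W -> R})
         (g : {ffun W -> R} -> {ffun V -> R}),
    [/\ PL_map K L f, PL_map L K g,
        forall x, realization K x -> g (f x) = x
      & forall y, realization L y -> f (g y) = y].

Definition PL_ball (d : nat) (V : finType) (K : simplicial_complex V) : Prop :=
  PL_homeomorphic K (simplex d).

Definition PL_sphere (d : nat) (V : finType) (K : simplicial_complex V) :
  Prop := PL_homeomorphic K (simplex_boundary d.+1).

End PL.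

(* Main.v *)
(* Let [x] be the element covered by [z]. The interval [[x, \top]] is
   [[x, c]] times a two-element chain; write [tau y] for the upper copy of
   [y], so that [z = tau x].

   If [x] is not [\bot], then [P - z] and [P] have PL homeomorphic order
   complexes: subdivide the edge [{x, c}], rename [x] to [z] and the new vertex
   to [x], and then, for [y] running downwards through the open interval
   [(x, c)], flip the edge [{z, y}] into [{x, tau y}]; a flip is an edge
   subdivision followed by the inverse of another. A sphere is excluded because
   [x] is adjacent to everything in the link of [z], so that a maximal simplex
   of the rest of the link lies in exactly one larger simplex, which is
   impossible in the link of a vertex of a PL sphere.

   If [x = \bot], then welding each [y] in [(x, c)] into the edge
   [{c, tau y}] turns the order complex of [P - z] into a cone over the link of
   [z], that is, into the star of [z]; and the star of a vertex in a PL ball or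
   sphere is a PL ball.

   Both facts on vertices are proved in the tangent cone. A PL homeomorphism
   [f] is linear along small segments leaving a vertex, and becomes linear on
   each simplex of the link after finitely many edge subdivisions: cutting the
   edges where a functional changes sign never creates new sign changes for
   functionals already treated. The tangent cone of the target is identified
   linearly with that of a simplex; a last subdivision makes the gauge of that
   simplex linear too, and rescaling the vertices gives the homeomorphism. *)
Require Import Defs.
From HB Require Import structures.
From mathcomp Require Import all_boot all_order all_algebra.
From mathcomp Require Import boolp reals.
From mathcomp Require Import lra ring.

Set Implicit Arguments.
Unset Strict Implicit.
Unset Printing Implicit Defensive.

Import Order.TTheory GRing.Theory Num.Theory.
Local Open Scope ring_scope.

(** * Piecewise linear maps *)

(** The complexes on the poset side are all flag, and subdividing an edge keeps them so: a graph
    stands for the complex, and a subdivision adds one vertex to the graph. The boundary of a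
    simplex is not flag, so the targets are described directly, as sets of points. Letting the mass
    vary makes subdivision maps linear, and one map serves both the complex (mass 1) and the
    truncated cone over a link (mass at most 1). The obstacle is that a PL homeomorphism is given by
    formulas on polyhedra, with no triangulation on which it is simplicial; what it says about links
    has to be extracted from its germ at a vertex. Three facts are kept: a linear [Q] sends the
    refined link cone to directions of a simplex at a point [t0], [Q] is injective on that cone, and
    a PL section [B] reaches every point of the simplex. They suffice for both applications: with a
    gauge they make the star a ball, and with [t0] interior, as for the boundary of a simplex, they
    forbid a free face. No homology is involved. *)

(* [{ffun V -> R}] with the vector space structure inherited from
   [{ffun V -> R^o}]; the library has no canonical one on [{ffun V -> R}]. *)
Definition point (R : realType) (V : finType) := {ffun V -> R}.

HB.instance Definition _ (R : realType) (V : finType) :=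
  GRing.Lmodule.copy (point R V) {ffun V -> R^o}.

Section Points.
Variable R : realType.
Local Notation pt := (point R).

Lemma ptD (V : finType) (x y : pt V) v : (x + y) v = x v + y v.
Proof. by rewrite [LHS]ffunE. Qed.

Lemma ptZ (V : finType) c (x : pt V) v : (c *: x) v = c * x v.
Proof. by rewrite [LHS]ffunE. Qed.

Lemma ptN (V : finType) (x : pt V) v : (- x) v = - x v.
Proof. by rewrite [LHS]ffunE. Qed.

Lemma pt0 (V : finType) v : (0 : pt V) v = 0.
Proof. by rewrite [LHS]ffunE. Qed.

Lemma pt_sum (V : finType) (I : Type) (r : seq I) (P : pred I)
    (F : I -> pt V) v : (\sum_(i <- r | P i) F i) v = \sum_(i <- r | P i) F i v.
Proof. by elim/big_rec2: _ => [|i y x _ <-]; rewrite ?pt0 ?ptD. Qed.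

Definition ptE := (ptD, ptN, ptZ, pt0).

(** The vertex [v] as a point of the realization. *)
Definition pole (V : finType) (v : V) : pt V := [ffun u => (u == v)%:R].

Definition dot (V : finType) (a x : pt V) : R := \sum_v a v * x v.

Definition mass (V : finType) (x : pt V) : R := \sum_v x v.

Definition mxlin (V W : finType) (A : W -> V -> R) (x : pt V) : pt W :=
  [ffun w => \sum_v A w v * x v].

Lemma mxlin_is_linear (V W : finType) (A : W -> V -> R) : linear (mxlin A).
Proof.
move=> c x y; apply/ffunP => w; rewrite !ptE !ffunE mulr_sumr -big_split /=.
by apply: eq_bigr => v _; rewrite !ptE mulrDr mulrCA.
Qed.

HB.instance Definition _ (V W : finType) (A : W -> V -> R) :=
  GRing.isLinear.Build R (pt V) (pt W) _ (mxlin A) (@mxlin_is_linear V W A).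

Lemma dot_is_linear (V : finType) (a : pt V) : scalar (dot a).
Proof.
move=> c x y; rewrite /dot big_distrr -big_split /=.
by apply: eq_bigr => v _; rewrite !ptE mulrDr mulrCA.
Qed.

HB.instance Definition _ (V : finType) (a : pt V) :=
  GRing.isLinear.Build R (pt V) R _ (dot a) (@dot_is_linear V a).

Lemma mass_is_linear (V : finType) : scalar (@mass V).
Proof.
move=> c x y; rewrite /mass big_distrr -big_split /=.
by apply: eq_bigr => v _; rewrite !ptE.
Qed.

HB.instance Definition _ (V : finType) :=
  GRing.isLinear.Build R (pt V) R _ (@mass V) (@mass_is_linear V).

Lemma mass_pole (V : finType) (v : V) : mass (pole v) = 1.
Proof.
rewrite /mass (bigD1 v) //= big1 ?addr0 ?ffunE ?eqxx // => u.
by rewrite ffunE => /negbTE->.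
Qed.

Lemma massD (V : finType) (x y : pt V) : mass (x + y) = mass x + mass y.
Proof. exact: linearD. Qed.

Lemma massZ (V : finType) c (x : pt V) : mass (c *: x) = c * mass x.
Proof. exact: linearZ. Qed.

Lemma massB (V : finType) (x y : pt V) : mass (x - y) = mass x - mass y.
Proof. exact: linearB. Qed.

Lemma mass_ge0 (V : finType) (x : pt V) : (forall v, 0 <= x v) -> 0 <= mass x.
Proof. by move=> x0; apply: sumr_ge0. Qed.

Lemma dot_pole (V : finType) (v : V) (x : pt V) : dot (pole v) x = x v.
Proof.
rewrite /dot (bigD1 v) //= big1 ?addr0 ?ffunE ?eqxx ?mul1r // => u.
by rewrite ffunE => /negbTE->; rewrite mul0r.
Qed.

Lemma pole_sum (V : finType) (x : pt V) : x = \sum_v x v *: pole v.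
Proof.
apply/ffunP => u; rewrite pt_sum (bigD1 u) //= big1 => [|v vu].
  by rewrite ptZ ffunE eqxx addr0 mulr1.
by rewrite ptZ ffunE eq_sym (negbTE vu) mulr0.
Qed.

Lemma lin_coord (V W : finType) (f : {linear pt V -> pt W}) x w :
  f x w = \sum_v f (pole v) w * x v.
Proof.
rewrite {1}(pole_sum x) linear_sum pt_sum; apply: eq_bigr => v _.
by rewrite linearZ ptZ mulrC.
Qed.

Lemma scal_coord (V : finType) (f : {scalar pt V}) x :
  f x = \sum_v f (pole v) * x v.
Proof.
rewrite {1}(pole_sum x) linear_sum; apply: eq_bigr => v _.
by rewrite linearZ /= mulrC.
Qed.

Section Affine.
Variables V W : finType.
Implicit Types (D : pt V -> Prop) (f : pt V -> pt W).

Lemma affine_lin D (f : {linear pt V -> pt W}) : affine_on D f.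
Proof.
exists (fun w v => f (pole v) w), (fun=> 0) => x _ w.
by rewrite addr0 lin_coord.
Qed.

Lemma affine_cst D c : affine_on D (fun=> c : pt W).
Proof.
exists (fun _ _ => 0), c => x _ w; rewrite big1 ?add0r // => v _.
by rewrite mul0r.
Qed.

Lemma affineD D f g :
  affine_on D f -> affine_on D g -> affine_on D (fun x => f x + g x).
Proof.
move=> [A [b Hf]] [A' [b' Hg]].
exists (fun w v => A w v + A' w v), (fun w => b w + b' w) => x Dx w.
rewrite ptD Hf // Hg // addrACA; congr (_ + _).
by rewrite -big_split; apply: eq_bigr => v _; rewrite mulrDl.
Qed.

Lemma affineZ D f c : affine_on D f -> affine_on D (fun x => c *: f x).
Proof.
move=> [A [b Hf]].
exists (fun w v => c * A w v), (fun w => c * b w) => x Dx w.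
rewrite ptZ Hf // mulrDr; congr (_ + _).
by rewrite mulr_sumr; apply: eq_bigr => v _; rewrite mulrA.
Qed.

Lemma affineB D f g :
  affine_on D f -> affine_on D g -> affine_on D (fun x => f x - g x).
Proof.
move=> Hf /(affineZ (-1)) Hg; have [A [b Hfg]] := affineD Hf Hg.
by exists A, b => x Dx w; rewrite -Hfg // scaleN1r.
Qed.

Lemma affine_sub D D' f :
  (forall x, D' x -> D x) -> affine_on D f -> affine_on D' f.
Proof. by move=> DD [A [b Hf]]; exists A, b => x /DD; apply: Hf. Qed.

Lemma affine_ext D f g :
  (forall x, D x -> f x = g x) -> affine_on D f -> affine_on D g.
Proof. by move=> fg [A [b Hf]]; exists A, b => x Dx w; rewrite -fg ?Hf. Qed.

Lemma affine_linP D f : affine_on D f ->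
  exists (A : {linear pt V -> pt W}) (b : pt W), forall x, D x -> f x = A x + b.
Proof.
move=> [A [b Hf]]; exists (mxlin A), [ffun w => b w] => x Dx.
by apply/ffunP => w; rewrite ptD !ffunE Hf.
Qed.

End Affine.

Lemma affine_comp (U V W : finType) (D : pt U -> Prop) (E : pt V -> Prop)
    (f : pt U -> pt V) (g : pt V -> pt W) :
  affine_on D f -> affine_on E g -> (forall x, D x -> E (f x)) ->
  affine_on D (g \o f).
Proof.
move=> /affine_linP[A [b Hf]] /affine_linP[A' [b' Hg]] DE.
have: affine_on D (fun x => A' (A x) + (A' b + b')).
  by apply: affineD; [exact: (affine_lin _ (A' \o A)) | exact: affine_cst].
apply: affine_ext => x Dx /=; rewrite Hg; last exact: DE.
by rewrite Hf // linearD addrA.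
Qed.

Definition polyhedral (V : finType) (D : pt V -> Prop) : Prop :=
  exists Cs : seq (polyhedron R V),
    forall x, D x <-> exists2 C, C \in Cs & in_polyhedron C x.

(** The second clause of [PL_map] for an arbitrary domain. The pieces cover [D] exactly, so [D] is
    polyhedral as part of the definition. *)
Definition PL_on (V W : finType) (D : pt V -> Prop) (f : pt V -> pt W) : Prop :=
  exists Cs : seq (polyhedron R V),
    (forall x, D x <-> exists2 C, C \in Cs & in_polyhedron C x) /\
    (forall C, C \in Cs -> affine_on (in_polyhedron C) f).

Lemma in_polyhedron_cat (V : finType) (C D : polyhedron R V) x :
  in_polyhedron (C ++ D) x <-> in_polyhedron C x /\ in_polyhedron D x.
Proof.
split=> [H | [HC HD] h].
  by split=> h hC; apply: H; rewrite mem_cat hC ?orbT.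
by rewrite mem_cat => /orP[/HC|/HD].
Qed.

Lemma polyhedral_ext (V : finType) (D E : pt V -> Prop) :
  (forall x, D x <-> E x) -> polyhedral D -> polyhedral E.
Proof. by move=> DE [Cs H]; exists Cs => x; rewrite -DE. Qed.

Lemma polyhedralT (V : finType) : polyhedral (fun _ : pt V => True).
Proof. by exists [:: [::]] => x; split=> // _; exists [::]; rewrite ?mem_head. Qed.

Lemma polyhedral_half (V : finType) (l : {scalar pt V}) (b : R) :
  polyhedral (fun x => l x <= b).
Proof.
exists [:: [:: ([ffun v => l (pole v)], b)]] => x; rewrite scal_coord; split.
  move=> lx; eexists; first exact: mem_head.
  move=> h; rewrite inE => /eqP-> /=; apply: le_trans lx.
  by under eq_bigr do rewrite ffunE.
move=> [C]; rewrite inE => /eqP-> /(_ _ (mem_head _ _)) /=.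
by under eq_bigr do rewrite ffunE.
Qed.

Lemma polyhedral_half_ge (V : finType) (l : {scalar pt V}) (b : R) :
  polyhedral (fun x => b <= l x).
Proof.
have := polyhedral_half (\- l : {scalar pt V}) (- b); apply: polyhedral_ext => x.
by rewrite /= lerN2.
Qed.

Lemma polyhedralI (V : finType) (D E : pt V -> Prop) :
  polyhedral D -> polyhedral E -> polyhedral (fun x => D x /\ E x).
Proof.
move=> [Cs HC] [Ds HD]; exists [seq C ++ D' | C <- Cs, D' <- Ds] => x; split.
  move=> [/HC[C Cin Cx] /HD[D' Din Dx]]; exists (C ++ D').
    by apply/allpairsP; exists (C, D').
  exact/in_polyhedron_cat.
move=> [_ /allpairsP[[C D'] /= [Cin Din ->]] /in_polyhedron_cat[Cx Dx]].
by split; [apply/HC; exists C | apply/HD; exists D'].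
Qed.

Lemma polyhedral_all (V : finType) (I : eqType) (s : seq I)
    (D : I -> pt V -> Prop) :
  (forall i, polyhedral (D i)) ->
  polyhedral (fun x => forall i, i \in s -> D i x).
Proof.
move=> HD; elim: s => [|i s IHs].
  exists [:: [::]] => x; split=> // _; exists [::] => //; exact: mem_head.
apply: polyhedral_ext (polyhedralI (HD i) IHs) => x; split.
  by move=> [Dx H] j; rewrite inE => /predU1P[->|/H].
by move=> H; split=> [|j js]; apply: H; rewrite inE ?eqxx ?js ?orbT.
Qed.

Lemma polyhedral_ex (V : finType) (I : eqType) (s : seq I)
    (D : I -> pt V -> Prop) :
  (forall i, polyhedral (D i)) ->
  polyhedral (fun x => exists2 i, i \in s & D i x).
Proof.
move=> HD; elim: s => [|i s [Cs IHs]].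
  by exists [::] => x; split=> -[].
have [Ds HDs] := HD i; exists (Ds ++ Cs) => x; split.
  move=> [j]; rewrite inE => /predU1P[->|js] Dx.
    by have /HDs[C Cin Cx] := Dx; exists C; rewrite ?mem_cat ?Cin.
  have /IHs[C Cin Cx] : exists2 i, i \in s & D i x by exists j.
  by exists C; rewrite ?mem_cat ?Cin ?orbT.
move=> [C]; rewrite mem_cat => /orP[Cin Cx|Cin Cx].
  by exists i; rewrite ?mem_head //; apply/HDs; exists C.
have /IHs[j js Dx] : exists2 C, C \in Cs & in_polyhedron C x by exists C.
by exists j; rewrite // inE js orbT.
Qed.

Section PLOn.
Variables V W : finType.
Implicit Types (D E : pt V -> Prop) (f g : pt V -> pt W).

Lemma PL_on_affine D f : polyhedral D -> affine_on D f -> PL_on D f.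
Proof.
move=> [Cs H] Hf; exists Cs; split=> // C Cin; apply: affine_sub Hf => x Cx.
by apply/H; exists C.
Qed.

Lemma PL_on_lin D (f : {linear pt V -> pt W}) : polyhedral D -> PL_on D f.
Proof. by move=> HD; apply: PL_on_affine HD (affine_lin _ _). Qed.

Lemma PL_on_ext D E f g : (forall x, D x <-> E x) ->
  (forall x, D x -> f x = g x) -> PL_on D f -> PL_on E g.
Proof.
move=> DE fg [Cs [H Hf]]; exists Cs; split=> [x|C Cin]; first by rewrite -DE.
by apply: affine_ext (Hf _ Cin) => x Cx; apply: fg; apply/H; exists C.
Qed.

Lemma PL_onI D E f : PL_on D f -> polyhedral E -> PL_on (fun x => D x /\ E x) f.
Proof.
move=> [Cs [HC Hf]] [Ds HD]; exists [seq C ++ B | C <- Cs, B <- Ds].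
split=> [x|_ /allpairsP[[C B] /= [Cin Din ->]]]; last first.
  by apply: affine_sub (Hf _ Cin) => x /in_polyhedron_cat[].
split.
  move=> [/HC[C Cin Cx] /HD[B Din Dx]]; exists (C ++ B).
    by apply/allpairsP; exists (C, B).
  exact/in_polyhedron_cat.
move=> [_ /allpairsP[[C B] /= [Cin Din ->]] /in_polyhedron_cat[Cx Dx]].
by split; [apply/HC; exists C | apply/HD; exists B].
Qed.

Lemma PL_on_cover (I : eqType) (s : seq I) (E : I -> pt V -> Prop) D f :
  (forall x, D x <-> exists2 i, i \in s & E i x) ->
  (forall i, i \in s -> PL_on (E i) f) -> PL_on D f.
Proof.
elim: s D => [|i s IHs] D HD Hf.
  by exists [::]; split=> // x; split=> [/HD[]|[]].
have [Cs [HCs Hfs]] := Hf i (mem_head _ _).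
have {}IHs : PL_on (fun x => exists2 i, i \in s & E i x) f.
  by apply: IHs => // j js; apply: Hf; rewrite inE js orbT.
have [Ds [HDs Hfd]] := IHs.
exists (Cs ++ Ds); split=> [x|C].
  split=> [/HD[j]|[C]].
    rewrite inE => /predU1P[->|js] Ex.
      by have /HCs[C Cin Cx] := Ex; exists C; rewrite ?mem_cat ?Cin.
    have /HDs[C Cin Cx] : exists2 i, i \in s & E i x by exists j.
    by exists C; rewrite ?mem_cat ?Cin ?orbT.
  rewrite mem_cat => /orP[Cin Cx|Cin Cx]; apply/HD.
    by exists i; rewrite ?mem_head //; apply/HCs; exists C.
  have /HDs[j js Ex] : exists2 C, C \in Ds & in_polyhedron C x by exists C.
  by exists j; rewrite // inE js orbT.
by rewrite mem_cat => /orP[/Hfs|/Hfd].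
Qed.

End PLOn.

(** A piece of the composite consists of the points of [C] that [f] sends into [D']. As [f] is
    affine on [C], the inequalities of [D'] pull back to affine inequalities. *)
Lemma PL_on_comp (U V W : finType) (D : pt U -> Prop) (E : pt V -> Prop)
    (f : pt U -> pt V) (g : pt V -> pt W) :
  PL_on D f -> PL_on E g -> (forall x, D x -> E (f x)) -> PL_on D (g \o f).
Proof.
move=> [Cs [HC Hf]] [Ds [HD Hg]] DE.
have polyC (C : polyhedron R U) : polyhedral (in_polyhedron C).
  exists [:: C] => x; split=> [Cx|[C']]; first by exists C; rewrite ?mem_head.
  by rewrite inE => /eqP->.
apply: (@PL_on_cover _ _ _ [seq (C, D') | C <- Cs, D' <- Ds]
  (fun p x => in_polyhedron p.1 x /\ in_polyhedron p.2 (f x))) => [x|].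
  split=> [Dx|[_ /allpairsP[[C D'] /= [Cin Din ->]] /= [Cx Dx]]].
    have /HC[C Cin Cx] := Dx; have /HD[D' Din Dfx] := DE _ Dx.
    by exists (C, D') => //; apply/allpairsP; exists (C, D').
  by apply/HC; exists C.
move=> _ /allpairsP[[C D'] /= [Cin Din ->]] /=.
have affC := Hf _ Cin; have affD := Hg _ Din.
apply: PL_on_affine; last first.
  apply: (affine_comp (E := in_polyhedron D') _ affD) => [|x []//].
  by apply: affine_sub affC => x [].
have [A [b HA]] := affine_linP affC.
suff: polyhedral (fun x => in_polyhedron C x /\ in_polyhedron D' (A x + b)).
  by apply: polyhedral_ext => x; split=> -[Cx Dx]; split=> //;
    rewrite ?HA // -?HA.
apply: polyhedralI (polyC C) _.
apply: (polyhedral_ext (D := fun x => forall h, h \in D' ->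
   (dot h.1 \o A) x <= h.2 - dot h.1 b)).
  move=> x; split=> H h hD; have := H _ hD.
    by rewrite /= lerBrDr -linearD.
  by rewrite /= lerBrDr -linearD.
by apply: polyhedral_all => h; apply: polyhedral_half.
Qed.

(** Between sets rather than complexes, so that truncated cones are allowed. *)
Definition PL_iso (V W : finType) (D : pt V -> Prop) (E : pt W -> Prop) : Prop :=
  exists (f : pt V -> pt W) (g : pt W -> pt V),
    [/\ PL_on D f /\ PL_on E g, forall x, D x -> E (f x),
        forall y, E y -> D (g y), forall x, D x -> g (f x) = x
      & forall y, E y -> f (g y) = y].

Lemma PL_homeomorphicE (V W : finType) (K : simplicial_complex V)
    (L : simplicial_complex W) :
  PL_homeomorphic R K L <-> PL_iso (@realization R V K) (@realization R W L).
Proof.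
split=> [[f [g [[fK [Cs [H1 H2]]] [gL [Ds [H3 H4]]] gf fg]]]|].
  by exists f, g; split=> //; split; [exists Cs | exists Ds].
move=> [f [g [[[Cs [H1 H2]] [Ds [H3 H4]]] fK gL gf fg]]].
by exists f, g; split=> //; split=> //; [exists Cs | exists Ds].
Qed.

Lemma PL_iso_sym (V W : finType) (D : pt V -> Prop) (E : pt W -> Prop) :
  PL_iso D E -> PL_iso E D.
Proof. by move=> [f [g [[Hf Hg] fD gE gf fg]]]; exists g, f. Qed.

Lemma PL_iso_trans (U V W : finType) (D : pt U -> Prop) (E : pt V -> Prop)
    (F : pt W -> Prop) : PL_iso D E -> PL_iso E F -> PL_iso D F.
Proof.
move=> [f [g [[Hf Hg] fD gE gf fg]]] [f' [g' [[Hf' Hg'] fD' gE' gf' fg']]].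
exists (f' \o f), (g \o g'); split=> /=.
- by split; [apply: PL_on_comp Hf Hf' fD | apply: PL_on_comp Hg' Hg gE'].
- by move=> x /fD/fD'.
- by move=> x /gE'/gE.
- by move=> x Dx; rewrite gf' ?gf //; apply: fD.
- by move=> x Dx; rewrite fg ?fg' //; apply: gE'.
Qed.

Lemma PL_iso_ext (V W : finType) (D D' : pt V -> Prop) (E E' : pt W -> Prop) :
  (forall x, D x <-> D' x) -> (forall x, E x <-> E' x) ->
  PL_iso D E -> PL_iso D' E'.
Proof.
move=> DD EE [f [g [[Hf Hg] fD gE gf fg]]]; exists f, g; split.
- by split; [apply: PL_on_ext Hf | apply: PL_on_ext Hg].
- by move=> x /DD/fD/EE.
- by move=> x /EE/gE/DD.
- by move=> x /DD/gf.
- by move=> x /EE/fg.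
Qed.

(** Serves to cut cones by a condition on the mass. *)
Lemma PL_iso_restrict (V W : finType) (D : pt V -> Prop) (E : pt W -> Prop)
    (D' : pt V -> Prop) (E' : pt W -> Prop) f g :
  [/\ PL_on D f /\ PL_on E g, forall x, D x -> E (f x),
        forall y, E y -> D (g y), forall x, D x -> g (f x) = x
      & forall y, E y -> f (g y) = y] ->
  polyhedral D' -> polyhedral E' ->
  (forall x, D x -> D' x -> E' (f x)) -> (forall x, E x -> E' x -> D' (g x)) ->
  PL_iso (fun x => D x /\ D' x) (fun x => E x /\ E' x).
Proof.
move=> [[Hf Hg] fD gE gf fg] PD PE fD' gE'; exists f, g; split.
- by split; apply: PL_onI.
- by move=> x [Dx D'x]; split; [apply: fD|apply: fD'].
- by move=> x [Dx D'x]; split; [apply: gE|apply: gE'].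
- by move=> x [/gf].
- by move=> x [/fg].
Qed.

End Points.

(** * Cones over flag complexes and edge subdivisions *)

Section Cones.
Variable R : realType.
Local Notation pt := (point R).

(* A graph [e] stands for its clique complex; its vertices are the [v] such
   that [e v v]. The cone of a complex lets the total mass of a point vary. *)
Definition clique (V : finType) (e : rel V) (s : {set V}) : bool :=
  [forall u in s, forall v in s, e u v].

Lemma cliqueP (V : finType) (e : rel V) (s : {set V}) :
  reflect {in s &, forall u v, e u v} (clique e s).
Proof.
apply: (iffP forall_inP) => [H u v us vs|H u us].
  by have /forall_inP := H u us; apply.
by apply/forall_inP => v vs; apply: H.
Qed.

Definition cone (V : finType) (e : rel V) (x : pt V) : Prop :=
  (forall v, 0 <= x v) /\ (forall u v, x u != 0 -> x v != 0 -> e u v).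

(** One polyhedron for each clique [s]: the orthant with the coordinates outside [s] forced to be 0.
    For [v] in [s] the upper bound is made vacuous by the zero functional. *)
Lemma cone_polyhedral (V : finType) (e : rel V) : polyhedral (cone e).
Proof.
apply: (polyhedral_ext (D := fun x => exists2 s : {set V},
  s \in [seq s <- enum {set V} | clique e s] &
  forall v, v \in enum V -> 0 <= dot (pole R v) x /\
    dot (if v \in s then 0 else pole R v) x <= 0)); last first.
  apply: polyhedral_ex => s; apply: polyhedral_all => v.
  apply: (polyhedralI (polyhedral_half_ge _ _) (polyhedral_half _ _)).
move=> x; split=> [[s]|[x0 xe]].
  rewrite mem_filter => /andP[/cliqueP es _] H.
  have supp v : x v != 0 -> v \in s.
    have [] := H v; first by rewrite mem_enum.
    case: (v \in s) => //; rewrite dot_pole => x0 x1.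
    by rewrite eq_le x0 x1.
  split=> [v|u v /supp us /supp vs]; last exact: es.
  by have [] := H v; rewrite ?mem_enum ?dot_pole.
exists [set v | x v != 0].
  rewrite mem_filter mem_enum andbT; apply/cliqueP => u v.
  by rewrite !inE; apply: xe.
move=> v _; rewrite dot_pole; split=> //; rewrite inE.
case: eqP => [E|_ /=]; first by rewrite dot_pole E.
by rewrite /dot big1 // => u _; rewrite pt0 mul0r.
Qed.

Lemma cone_ge0 (V : finType) (e : rel V) (x : pt V) v : cone e x -> 0 <= x v.
Proof. by case. Qed.

Lemma cone_sub (V : finType) (e : rel V) (x y : pt V) :
  cone e x -> (forall v, 0 <= y v) -> (forall v, x v = 0 -> y v = 0) ->
  cone e y.
Proof.
move=> [x0 xe] y0 xy; split=> // u v yu yv; apply: xe.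
  by apply: contra_neq yu; apply: xy.
by apply: contra_neq yv; apply: xy.
Qed.

Lemma coneZ (V : finType) (e : rel V) (x : pt V) c :
  0 <= c -> cone e x -> cone e (c *: x).
Proof.
move=> c0 ex; apply: (cone_sub ex) => v; rewrite ptZ ?mulr_ge0 ?(cone_ge0 v ex) //.
by move=> ->; rewrite mulr0.
Qed.

Lemma cone_pole (V : finType) (e : rel V) v : e v v -> cone e (pole R v).
Proof.
move=> ev; split=> [u|u w]; rewrite !ffunE ?ler0n //.
by case: (u =P v) => [->|_]; case: (w =P v) => [->|_]; rewrite // eqxx.
Qed.

(** [s] lies in exactly one larger simplex, [v |: s], as in an elementary collapse. The empty [s] is
    allowed. *)
Definition free_face (V : finType) (e : rel V) : Prop :=
  exists (s : {set V}) (v : V),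
    [/\ v \notin s, clique e (v |: s) &
        forall u, e u u -> u \notin s -> (forall w, w \in s -> e u w) -> u = v].

(** The map [phi] from the finer cone is linear, its inverse only PL. Mass is preserved so that the
    maps restrict to complexes and to truncated cones alike. [sub_free] lets the obstruction for
    spheres survive refinement. *)
Record subdivision (V V' : finType) (e : rel V) (e' : rel V')
    (phi : {linear pt V' -> pt V}) (psi : pt V -> pt V') : Prop := {
  sub_sym : symmetric e';
  sub_phi : forall x, cone e' x -> cone e (phi x);
  sub_psi : forall x, cone e x -> cone e' (psi x);
  sub_phiK : forall x, cone e' x -> psi (phi x) = x;
  sub_psiK : forall x, cone e x -> phi (psi x) = x;
  sub_PL : PL_on (cone e) psi;
  sub_mass : forall x, mass (phi x) = mass x;
  sub_free : free_face e -> free_face e'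
}.

Lemma subdivision_trans (V V' V'' : finType) (e : rel V) (e' : rel V')
    (e'' : rel V'') (phi : {linear pt V' -> pt V})
    (phi' : {linear pt V'' -> pt V'}) psi psi' :
  subdivision e e' phi psi -> subdivision e' e'' phi' psi' ->
  subdivision e e'' (phi \o phi') (psi' \o psi).
Proof.
move=> S S'; split=> /=.
- exact: sub_sym S'.
- by move=> x /(sub_phi S')/(sub_phi S).
- by move=> x /(sub_psi S)/(sub_psi S').
- by move=> x ex; rewrite (sub_phiK S) ?(sub_phiK S') //; apply: sub_phi S' _ ex.
- by move=> x ex; rewrite (sub_psiK S') ?(sub_psiK S) //; apply: sub_psi S _ ex.
- by apply: PL_on_comp (sub_PL S) (sub_PL S') _; apply: sub_psi S.
- by move=> x; rewrite (sub_mass S) (sub_mass S').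
- by move=> /(sub_free S)/(sub_free S').
Qed.

Lemma subdivision_refl (V : finType) (e : rel V) : symmetric e ->
  subdivision e e (idfun : {linear pt V -> pt V}) id.
Proof.
by move=> es; split=> //; apply: (PL_on_lin (idfun : {linear pt V -> pt V}));
  apply: cone_polyhedral.
Qed.

(** * Subdividing one edge of a flag complex *)

Section EdgeSubdivision.
Variables (V : finType) (e : rel V) (a b : V).

(* [None] is the new vertex, a point of the edge [{a, b}]. *)
Definition edge_sub : rel (option V) := fun u v =>
  match u, v with
  | None, None => true
  | None, Some w | Some w, None => e w a && e w b
  | Some u, Some v => e u v && ~~ ((u == a) && (v == b) || (u == b) && (v == a))
  end.

Hypotheses (e_sym : symmetric e) (ab : a != b) (eab : e a b)
  (eaa : e a a) (ebb : e b b).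

Lemma edge_sub_sym : symmetric edge_sub.
Proof.
move=> [u|] [v|] //=; rewrite e_sym; congr (_ && ~~ _).
by rewrite orbC ![(u == _) && _]andbC.
Qed.

(** If [{a, b}] lies in [s], replacing [b] by the new vertex gives a half of [s] that is still free,
    with the same [v]. If [b = v], then [s] itself survives, and the new vertex takes the place of
    [v]. *)
Lemma edge_sub_free_in (s : {set V}) v :
  v \notin s -> clique e (v |: s) ->
  (forall u, e u u -> u \notin s -> (forall w, w \in s -> e u w) -> u = v) ->
  a \in s -> b \in v |: s -> free_face edge_sub.
Proof.
move=> vs /cliqueP cl uniq as_.
have clS u w : u \in s -> w \in s -> e u w.
  by move=> us ws; apply: cl; rewrite inE ?us ?ws orbT.
have clv u : u \in s -> e v u.
  by move=> us; apply: cl; rewrite !inE ?eqxx ?us ?orbT.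
have [bs _|bs] := boolP (b \in s).
  have va : v != a by apply: contraNneq vs => ->.
  have vb : v != b by apply: contraNneq vs => ->.
  exists (None |: Some @: (s :\ b)), (Some v); split.
  - rewrite !inE /=; apply/imsetP => -[w]; rewrite !inE => /andP[_ ws] [vw].
    by move: vs; rewrite vw ws.
  - apply/cliqueP; have nb w : Some w \in Some v |: (None |: Some @: (s :\ b)) ->
        w \in v |: s /\ w != b.
      rewrite !inE /= => /orP[/eqP[->]|/imsetP[x]]; first by rewrite eqxx.
      by rewrite !inE => /andP[xb xs] [->]; rewrite xs orbT.
    move=> [u|] [w|] //=.
    + move=> /nb[us ub] /nb[ws wb]; rewrite cl //=.
      by rewrite (negbTE ub) (negbTE wb) !andbF.
    + by move=> /nb[us ub] _; rewrite !cl // inE ?as_ ?bs orbT.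
    + by move=> _ /nb[us ub]; rewrite !cl // inE ?as_ ?bs orbT.
  - move=> [w|] /=; last by rewrite !inE.
    move=> /andP[ew _]; rewrite !inE /= => ws H.
    have mem_s x : x \in s -> x != b -> Some x \in None |: Some @: (s :\ b).
      by move=> xs xb; rewrite !inE /=; apply/imsetP; exists x; rewrite // !inE xb.
    congr Some; apply: uniq => //.
      apply: contra ws => ws; apply/imsetP; exists w; rewrite // !inE ws andbT.
      (* [b] is excluded: it is no longer adjacent to [a]. *)
      by apply/eqP => wb; have := H _ (mem_s _ as_ ab); rewrite wb /= !eqxx orbT andbF.
    move=> x xs; have [->|xb] := eqVneq x b.
      by have /andP[] : e w a && e w b by apply: (H None); rewrite !inE.
    by have /andP[] := H _ (mem_s _ xs xb).
rewrite inE (negbTE bs) orbF inE => /eqP vb.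
have mem_s x : (Some x \in Some @: s) = (x \in s) by rewrite mem_imset // => ? ? [].
exists (Some @: s), None; split.
- by apply/imsetP => -[].
- apply/cliqueP => -[u|] [w|]; rewrite ?inE ?mem_s //= => us ws.
  + rewrite clS //= negb_or !negb_and; apply/andP; split; apply/orP.
      by right; apply: contraNneq bs => <-.
    by left; apply: contraNneq bs => <-.
  + by rewrite clS // e_sym vb clv.
  + by rewrite clS // e_sym vb clv.
- move=> [w|] //= /andP[ew _]; rewrite mem_s => ws H.
  have wv : w = v.
    apply: uniq => // x xs.
    by have /andP[] := H (Some x) (etrans (mem_s x) xs).
  by have := H (Some a); rewrite wv -vb /= !eqxx orbT andbF mem_s => /(_ as_).
Qed.

(** Here [s] and [v] are untouched. If the new vertex extended [s], then [a] and [b] would be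
    adjacent to all of [s], so each would lie in [s] or equal [v] by uniqueness. *)
Lemma edge_sub_free_out (s : {set V}) v :
  v \notin s -> clique e (v |: s) ->
  (forall u, e u u -> u \notin s -> (forall w, w \in s -> e u w) -> u = v) ->
  ~~ ((a \in v |: s) && (b \in v |: s)) -> free_face edge_sub.
Proof.
move=> vs /cliqueP cl uniq nab.
have mem_s x : (Some x \in Some @: s) = (x \in s) by rewrite mem_imset // => ? ? [].
exists (Some @: s), (Some v); split; first by rewrite mem_s.
  apply/cliqueP => -[u|] [w|]; rewrite ?inE /=.
  + rewrite !(inj_eq Some_inj) !mem_s => us ws; rewrite cl ?inE //=.
    apply/negP => H; case/negP: nab.
    by case/orP: H => /andP[/eqP<- /eqP<-]; rewrite !inE us ws.
  + by move=> _ /imsetP[].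
  + by move=> /imsetP[].
  + by move=> /imsetP[].
move=> [w|] /=.
  move=> /andP[ew _]; rewrite mem_s => ws H; congr Some; apply: uniq => // x xs.
  by have /andP[] := H (Some x) (etrans (mem_s x) xs).
move=> _ _ H; case/negP: nab.
have Ha x : x \in s -> e x a /\ e x b.
  by move=> xs; apply/andP; apply: (H (Some x)); rewrite mem_s.
have av : a \in v |: s.
  rewrite inE; have [_|as_] := boolP (a \in s); first by rewrite orbT.
  by rewrite orbF inE; apply/eqP/uniq => // x /Ha[]; rewrite e_sym.
have bv : b \in v |: s.
  rewrite inE; have [_|as_] := boolP (b \in s); first by rewrite orbT.
  by rewrite orbF inE; apply/eqP/uniq => // x /Ha[_]; rewrite e_sym.
by rewrite av bv.
Qed.

Variable th : R.
Hypotheses (th_gt0 : 0 < th) (th_lt1 : th < 1).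

(** Barycentric coordinates of the new vertex. *)
Let theta (v : V) : R := if v == a then th else if v == b then 1 - th else 0.

Let theta_ge0 v : 0 <= theta v.
Proof. by move: th_gt0 th_lt1 => ? ?; rewrite /theta; do 2?case: ifP => _; lra. Qed.

Let theta_a : theta a = th. Proof. by rewrite /theta eqxx. Qed.
Let theta_b : theta b = 1 - th.
Proof. by rewrite /theta eq_sym (negbTE ab) eqxx. Qed.

Let theta_neq0 v : theta v != 0 -> v = a \/ v = b.
Proof.
rewrite /theta; have [|_] := eqVneq v a; first by left.
by have [|_] := eqVneq v b; [right | rewrite eqxx].
Qed.

Definition edge_phi : {linear pt (option V) -> pt V} :=
  mxlin (fun v o => if o is Some u then (u == v)%:R else theta v).

Lemma edge_phiE x v : edge_phi x v = x (Some v) + theta v * x None.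
Proof.
rewrite ffunE (bigD1 None) //= addrC (bigD1 (Some v)) //= eqxx mul1r.
rewrite [X in _ + X + _ = _]big1 ?addr0 // => -[u|] //= /negbTE.
by rewrite (inj_eq Some_inj) => ->; rewrite mul0r.
Qed.

(** The largest multiple of the new vertex that can be subtracted from [x] while keeping all
    coordinates non-negative. *)
Let mu (x : pt V) : R := Num.min (x a / th) (x b / (1 - th)).

Definition edge_psi (x : pt V) : pt (option V) :=
  [ffun o => if o is Some v then x v - theta v * mu x else mu x].

Let psi_ge0 (x : pt V) o : (forall v, 0 <= x v) -> 0 <= edge_psi x o.
Proof.
move=> x0; move: th_gt0 th_lt1 => t0 t1.
have mu0 : 0 <= mu x.
  by rewrite le_min !divr_ge0 //; lra.
rewrite ffunE; case: o => [v|//].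
have [E|/theta_neq0[->|->]] := eqVneq (theta v) 0.
- by rewrite E mul0r subr0.
- rewrite theta_a subr_ge0 mulrC -ler_pdivlMr; last by lra.
  by rewrite ge_min lexx.
- rewrite theta_b subr_ge0 mulrC -ler_pdivlMr; last by lra.
  by rewrite ge_min lexx orbT.
Qed.

Let psi_ab (x : pt V) : edge_psi x (Some a) = 0 \/ edge_psi x (Some b) = 0.
Proof.
move: th_gt0 th_lt1 => t0 t1.
rewrite !ffunE theta_a theta_b /mu; have [_|_] := leP (x a / th) (x b / (1 - th)).
  by left; field; lra.
by right; field; lra.
Qed.

Hypothesis edge_free : free_face e -> free_face edge_sub.

Lemma edge_subdivision_of_free : subdivision e edge_sub edge_phi edge_psi.
Proof.
move: th_gt0 th_lt1 => t0 t1; split.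
- exact: edge_sub_sym.
- move=> x [x0 xe]; split=> [v|u v].
    by rewrite edge_phiE addr_ge0 ?mulr_ge0.
  have supp w : edge_phi x w != 0 ->
      x (Some w) != 0 \/ (x None != 0 /\ (w = a \/ w = b)).
    rewrite edge_phiE; have [-> H|] := eqVneq (x (Some w)) 0; last by left.
    right; split; first by apply: contra_neq H => ->; rewrite mulr0 addr0.
    by apply: theta_neq0; apply: contra_neq H => ->; rewrite mul0r addr0.
  move=> /supp[xu|[xN uab]] /supp[xv|[xN' vab]].
  + by have /andP[] := xe _ _ xu xv.
  + by have /andP[] := xe _ _ xu xN'; case: vab => ->.
  + by rewrite e_sym; have /andP[] := xe _ _ xv xN; case: uab => ->.
  + by case: uab => ->; case: vab => ->; rewrite // e_sym.
- move=> x [x0 xe]; split=> [o|]; first exact: psi_ge0.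
  have suppS w : edge_psi x (Some w) != 0 -> x w != 0.
    apply: contra_neq => xw; apply/le_anti; rewrite psi_ge0 // andbT.
    have := psi_ge0 None x0; rewrite !ffunE xw => m0.
    by rewrite sub0r oppr_le0 mulr_ge0.
  have suppN : edge_psi x None != 0 -> x a != 0 /\ x b != 0.
    rewrite ffunE => m0; split; apply: contra_neq m0 => E; rewrite /mu E mul0r;
    [rewrite min_l|rewrite min_r] => //; rewrite divr_ge0 //; lra.
  have eN w : edge_psi x None != 0 -> edge_psi x (Some w) != 0 -> e w a && e w b.
    by move=> /suppN[xa xb] /suppS xw; rewrite !xe.
  move=> [u|] [v|] //= xu xv; rewrite ?eN // xe ?suppS //=.
  apply/negP => H; have [E|E] := psi_ab x; case/orP: H => /andP[/eqP eu /eqP ev];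
  by move: xu xv; rewrite eu ev E eqxx.
(* [a] and [b] are no longer adjacent, so one of their coordinates in [x] is 0, and the minimum is
   attained there. *)
- move=> x [x0 xe]; have muE : mu (edge_phi x) = x None.
    rewrite /mu !edge_phiE theta_a theta_b.
    have [E|xa] := eqVneq (x (Some a)) 0.
      rewrite E add0r [th * _]mulrC mulfK; last by lra.
      rewrite min_l // ler_pdivlMr; last by lra.
      by rewrite mulrC lerDr.
    have E : x (Some b) = 0.
      have [//|xb] := eqVneq (x (Some b)) 0.
      by have := xe _ _ xa xb; rewrite /= eab !eqxx.
    rewrite E add0r [(1 - th) * _]mulrC mulfK; last by lra.
    rewrite min_r // ler_pdivlMr; last by lra.
    by rewrite mulrC lerDr.
  by apply/ffunP => -[v|]; rewrite ffunE muE // edge_phiE addrK.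
- by move=> x [x0 xe]; apply/ffunP => v; rewrite edge_phiE !ffunE subrK.
(* The sign of [l] tells which argument of the minimum is the smaller one; on either side [mu] is
   the linear functional [k]. *)
- pose l := \sum_(i <- [:: (th^-1, a); (- (1 - th)^-1, b)]) i.1 *: pole R i.2.
  have lE x : dot l x = x a / th - x b / (1 - th).
    rewrite /l /dot big_cons big_seq1 /=.
    under eq_bigr do rewrite !ptE mulrDl -!mulrA.
    rewrite big_split /= -!mulr_sumr.
    by have /= := dot_pole a x; have /= := dot_pole b x;
      rewrite /dot => -> ->; rewrite mulNr mulrC [_ * x b]mulrC.
  apply: (PL_on_cover (s := [:: true; false])
    (E := fun i x => cone e x /\ (if i then dot l x <= 0 else 0 <= dot l x))).
    move=> x; split=> [ex|[i _ []//]].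
    by have [le|/ltW le] := leP (dot l x) 0; [exists true | exists false].
  move=> i _; pose k := if i then th^-1 *: pole R a else (1 - th)^-1 *: pole R b.
  have kE x : dot k x = if i then x a / th else x b / (1 - th).
    by rewrite /k; case: (i); rewrite /dot;
    under eq_bigr do rewrite ptZ -mulrA;
    rewrite -mulr_sumr; [have := dot_pole a x|have := dot_pole b x];
    rewrite /dot => ->; rewrite mulrC.
  apply: (PL_on_ext (D := fun x => cone e x /\
       (if i then dot l x <= 0 else 0 <= dot l x))
     (f := mxlin (fun o v => if o is Some u then (u == v)%:R - theta u * k v
                             else k v))) => [x//|x [_ lx]|].
    have -> : edge_psi x = [ffun o => if o is Some v then x v - theta v * dot k x
                                    else dot k x].
      have mE : mu x = dot k x.
        rewrite kE /mu; move: lx; rewrite lE; case: (i) => lx.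
          by rewrite min_l //; lra.
        by rewrite min_r //; lra.
      by apply/ffunP => o; rewrite !ffunE mE.
    apply/ffunP => -[u|]; rewrite !ffunE //.
    under eq_bigr do rewrite mulrBl -mulrA.
    rewrite sumrB -mulr_sumr; congr (_ - _).
    rewrite (bigD1 u) //= eqxx mul1r big1 ?addr0 // => v.
    by rewrite eq_sym => /negbTE->; rewrite mul0r.
  apply: PL_on_lin; apply: polyhedralI; first exact: cone_polyhedral.
  by case: (i); [exact: polyhedral_half | exact: polyhedral_half_ge].
- move=> x; rewrite /mass (bigD1 None) //=.
  under eq_bigr do rewrite edge_phiE.
  rewrite big_split /= -mulr_suml addrC; congr (_ + _); last first.
    rewrite (reindex_omap Some id) => [|[o|]//]; apply: eq_big => // v.
    by rewrite eqxx.
  rewrite (bigD1 a) //= (bigD1 b) /=; last by rewrite eq_sym.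
  rewrite theta_a theta_b big1 ?addr0; last first.
    by move=> v /andP[/negbTE va /negbTE vb]; rewrite /theta va vb.
  by rewrite addrCA subrr addr0 mul1r.
- exact: edge_free.
Qed.

End EdgeSubdivision.

Lemma edge_subC (V : finType) (e : rel V) a b :
  edge_sub e a b = edge_sub e b a.
Proof.
apply/funext => -[u|]; apply/funext => -[v|] //=.
- by rewrite orbC.
- by rewrite andbC.
- by rewrite andbC.
Qed.

Lemma edge_sub_free (V : finType) (e : rel V) a b :
  symmetric e -> a != b -> e a b -> e a a -> e b b ->
  free_face e -> free_face (edge_sub e a b).
Proof.
move=> es ab eab ea eb [s [v [vs cl uniq]]].
have [/andP[av bv]|] := boolP ((a \in v |: s) && (b \in v |: s)); last first.
  exact: edge_sub_free_out cl uniq.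
have [as_|as_] := boolP (a \in s); first exact: edge_sub_free_in cl uniq as_ bv.
have [bs|bs] := boolP (b \in s).
  rewrite edge_subC; apply: edge_sub_free_in cl uniq bs av => //.
  by rewrite eq_sym.
move: av bv; rewrite !inE (negbTE as_) (negbTE bs) !orbF => /eqP av /eqP bv.
by rewrite av bv eqxx in ab.
Qed.

Lemma edge_subdivision (V : finType) (e : rel V) a b (th : R) :
  symmetric e -> a != b -> e a b -> e a a -> e b b -> 0 < th -> th < 1 ->
  subdivision e (edge_sub e a b) (edge_phi a b th) (edge_psi a b th).
Proof.
by move=> *; apply: edge_subdivision_of_free => //; apply: edge_sub_free.
Qed.
End Cones.

(** * Resolving the signs of linear functionals *)

Section Resolved.
Variable R : realType.
Local Notation pt := (point R).

(* That is, [l] has a weakly constant sign on every simplex. *)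
Definition resolved (V : finType) (e : rel V) (l : {scalar pt V}) : Prop :=
  forall x y, cone e x -> cone e y -> cone e (x + y) -> 0 <= l x * l y.

(** Stating [resolved] for points instead of vertices makes this immediate: [phi] is linear and maps
    cone to cone. *)
Lemma resolved_sub (V V' : finType) (e : rel V) (e' : rel V') phi psi
    (l : {scalar pt V}) :
  subdivision e e' phi psi -> resolved e l -> resolved e' (l \o phi).
Proof.
move=> S le x y ex ey exy; apply: le; try exact: sub_phi S _ _.
by rewrite -linearD; apply: sub_phi S _ _.
Qed.

(** Edges on which [l] changes sign, each listed once, from its negative to its positive end. *)
Let bad (V : finType) (e : rel V) (l : {scalar pt V}) : {set V * V} :=
  [set p | [&& e p.1 p.2, e p.1 p.1, e p.2 p.2,
            l (pole R p.1) < 0 & 0 < l (pole R p.2)]].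

Lemma edge_phi_Some (V : finType) (a b v : V) (th : R) :
  edge_phi a b th (pole R (Some v)) = pole R v.
Proof.
apply/ffunP => u; rewrite edge_phiE !ffunE mulr0 addr0.
by rewrite (inj_eq Some_inj).
Qed.

Lemma edge_phi_None (V : finType) (a b : V) (th : R) : a != b ->
  edge_phi a b th (pole R None) = th *: pole R a + (1 - th) *: pole R b.
Proof.
move=> ab; apply/ffunP => u; rewrite edge_phiE !ptE !ffunE /= add0r mulr1.
have [->|ua] := eqVneq u a; first by rewrite (negbTE ab) mulr0 mulr1 addr0.
by have [_|_] := eqVneq u b; rewrite ?mulr0 ?mulr1 add0r.
Qed.

(** Expand [l x * l y] over pairs of vertices. A pair with a non-zero coefficient lies in the
    support of [x + y], so it is an edge (or a single vertex), on which [l] does not change sign. *)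
Lemma resolved_bad0 (V : finType) (e : rel V) (l : {scalar pt V}) :
  symmetric e -> bad e l = set0 -> resolved e l.
Proof.
move=> es b0 x y [x0 _] [y0 _] [_ exy].
rewrite !(scal_coord l) mulr_suml sumr_ge0 // => u _.
rewrite mulr_sumr sumr_ge0 // => v _.
rewrite mulrACA.
have [->|xu] := eqVneq (x u) 0; first by rewrite mul0r mulr0.
have [->|yv] := eqVneq (y v) 0; first by rewrite !mulr0.
apply: mulr_ge0; last by rewrite mulr_ge0.
have xyu : (x + y) u != 0.
  by rewrite ptD gt_eqF // ltr_pwDl // lt_neqAle eq_sym xu x0.
have xyv : (x + y) v != 0.
  by rewrite ptD gt_eqF // ltr_wpDl // lt_neqAle eq_sym yv y0.
have euv := exy _ _ xyu xyv.
have euu := exy _ _ xyu xyu.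
have evv := exy _ _ xyv xyv.
have b1 : (u, v) \notin bad e l by rewrite b0 inE.
have b2 : (v, u) \notin bad e l by rewrite b0 inE.
move: b1 b2; rewrite !inE /= euu evv (es v u) euv /=.
move=> b1 b2.
have [lu|lu|->] := ltgtP (l (pole R u)) 0; last by rewrite mul0r.
- by rewrite nmulr_rge0 //; move: b1; rewrite lu /= -leNgt.
- by rewrite pmulr_rge0 //; move: b2; rewrite lu andbT -leNgt.
Qed.

(** Induction on the number of bad edges: a cut at the zero of [l] destroys the bad edge [{a, b}],
    and no edge at the new vertex is bad. *)
Lemma resolve (V : finType) (e : rel V) (l : {scalar pt V}) : symmetric e ->
  exists (V' : finType) (e' : rel V') (phi : {linear pt V' -> pt V}) psi,
    subdivision e e' phi psi /\ resolved e' (l \o phi).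
Proof.
move: {2}#|bad e l| (leqnn #|bad e l|) => n.
elim: n => [|n IHn] in V e l * => le es.
  exists V, e, (idfun : {linear pt V -> pt V}), id.
  split; first exact: subdivision_refl.
  have : resolved e l.
    by apply: resolved_bad0 => //; apply/eqP; rewrite -cards_eq0 -leqn0.
  by [].
have [b0|] := eqVneq (bad e l) set0.
  by apply: IHn; rewrite ?b0 ?cards0.
case/set0Pn => -[a b] bab; have := bab.
rewrite inE /= => /and5P[eab eaa ebb la lb].
have ab : a != b by apply: contraTneq lb => <-; rewrite -leNgt ltW.
(* The solution of [th * l a + (1 - th) * l b = 0], where [l a < 0 < l b]. *)
pose th := l (pole R b) / (l (pole R b) - l (pole R a)).
have th0 : 0 < th by rewrite divr_gt0 //; lra.
have th1 : th < 1 by rewrite ltr_pdivrMr; lra.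
have S := edge_subdivision es ab eab eaa ebb th0 th1.
have lN : l (edge_phi a b th (pole R None)) = 0.
  rewrite edge_phi_None // linearD !linearZ /= /th; field; lra.
have [||V' [e' [phi [psi [S' res]]]]] :=
    IHn _ (edge_sub e a b) (l \o edge_phi a b th).
- rewrite -ltnS; apply: leq_trans le; rewrite (cardsD1 (a, b) (bad e l)) bab ltnS.
  pose g (p : V * V) := (Some p.1, Some p.2).
  rewrite -(card_imset _ (_ : injective g)) => [|[? ?] [? ?] [-> ->] //].
  apply/subset_leq_card/subsetP => -[[u|] [v|]]; rewrite inE /= ?lN ?ltxx ?andbF //.
  rewrite !edge_phi_Some => /and5P[/andP[euv nab] /andP[euu _] /andP[evv _] lu lv].
  apply/imsetP; exists (u, v) => //; rewrite !inE /= euv euu evv lu lv !andbT.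
  by apply: contra nab => /eqP[-> ->]; rewrite !eqxx.
- exact: edge_sub_sym.
exists V', e', (edge_phi a b th \o phi : {linear _ -> _}), (psi \o edge_psi a b th).
by split; first exact: subdivision_trans S S'.
Qed.

Lemma resolve_seq (V : finType) (e : rel V) (T : eqType) (s : seq T)
    (l : T -> {scalar pt V}) : symmetric e ->
  exists (V' : finType) (e' : rel V') (phi : {linear pt V' -> pt V}) psi,
    subdivision e e' phi psi /\ forall t, t \in s -> resolved e' (l t \o phi).
Proof.
move=> es; elim: s => [|t s [V' [e' [phi [psi [S res]]]]]].
  by exists V, e, (idfun : {linear pt V -> pt V}), id; split=> //;
     apply: subdivision_refl.
have [V'' [e'' [phi' [psi' [S' res']]]]] := resolve (l t \o phi) (sub_sym S).
exists V'', e'', (phi \o phi' : {linear _ -> _}), (psi' \o psi).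
split; first exact: subdivision_trans S S'.
move=> u; rewrite inE => /predU1P[->|/res r]; first exact: res'.
exact: resolved_sub S' r.
Qed.

(** Split [x] into its part at [v] and the rest. If [l] were positive at [v], resolution would make
    it non-negative on the rest, hence positive at [x]. *)
Lemma resolved_pole (V : finType) (e : rel V) (l : {scalar pt V}) x v :
  resolved e l -> cone e x -> x v != 0 -> l x <= 0 -> l (pole R v) <= 0.
Proof.
move=> res ex xv lx; have x0 : 0 <= x v by case: ex.
have epv : cone e (pole R v) by apply/cone_pole; case: ex => _; apply.
pose y := x - x v *: pole R v.
have ey : cone e y.
  apply: (cone_sub ex) => u; rewrite /y !ptE ffunE.
    by have [->|_] := eqVneq u v; rewrite ?mulr1 ?subrr // mulr0 subr0; case: ex.
  move=> xu0; rewrite xu0; have [E|_] := eqVneq u v; last by rewrite mulr0 subr0.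
  by rewrite -E xu0 eqxx in xv.
have xE : x = x v *: pole R v + y by rewrite /y addrC subrK.
have := res (x v *: pole R v) y (coneZ x0 epv) ey; rewrite -xE => /(_ ex).
move: lx; rewrite {1}xE linearD linearZ /=.
set p := l _; set q := l _ => lx pq; rewrite leNgt; apply/negP => p0.
have xp : 0 < x v * p by rewrite mulr_gt0 // lt_neqAle eq_sym xv.
move: pq; rewrite pmulr_rge0 //; lra.
Qed.

(** Resolve every functional bounding a conical piece. A piece containing a point then contains all
    vertices in its support, so [f] is the linear extension of its values at the vertices. *)
Lemma linearize (V W : finType) (e : rel V) (f : pt V -> pt W) (T : eqType)
    (cs : seq T) (C : T -> seq (pt V)) (A : T -> {linear pt V -> pt W}) :
  symmetric e ->
  (forall x, cone e x ->
     exists2 t, t \in cs & forall a, a \in C t -> dot a x <= 0) ->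
  (forall t x, t \in cs -> cone e x -> (forall a, a \in C t -> dot a x <= 0) ->
     f x = A t x) ->
  exists (V' : finType) (e' : rel V') (phi : {linear pt V' -> pt V}) psi
      (E : {linear pt V' -> pt W}),
    subdivision e e' phi psi /\ forall x, cone e' x -> f (phi x) = E x.
Proof.
move=> es covC fC.
have [V' [e' [phi [psi [S res]]]]] :=
  resolve_seq (flatten [seq C t | t <- cs]) (fun a => dot a : {scalar pt V}) es.
exists V', e', phi, psi,
  (mxlin (fun w v => f (phi (pole R v)) w) : {linear pt V' -> pt W}).
split=> // x ex; have ephx := sub_phi S ex.
have [t tcs xt] := covC _ ephx.
rewrite (fC t) // {1}(pole_sum x) !linear_sum.
apply/ffunP => w; rewrite pt_sum ffunE; apply: eq_bigr => v _.
have [->|xv] := eqVneq (x v) 0; first by rewrite scale0r !linear0 pt0 mulr0.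
have epv : cone e' (pole R v) by apply/cone_pole; case: ex => _; apply.
rewrite !linearZ /= ptZ mulrC; congr (_ * _).
rewrite -(fC t) //; first exact: sub_phi S _ epv.
move=> a aC; apply: (resolved_pole _ ex xv (l := dot a \o phi)); last exact: xt.
by apply: res; apply/flattenP; exists (C t) => //; apply: map_f.
Qed.

End Resolved.

(** * Germs and tangent cones *)

Section Germs.
Variable R : realType.
Local Notation pt := (point R).

(** Germs at 0 from the right; they take the place of limits throughout. *)
Definition soon (P : R -> Prop) : Prop :=
  exists2 r, 0 < r & forall t, 0 < t -> t <= r -> P t.

Lemma soon_and P Q : soon P -> soon Q -> soon (fun t => P t /\ Q t).
Proof.
move=> [r r0 HP] [s s0 HQ]; exists (Num.min r s); first by rewrite lt_min r0.
by move=> t t0; rewrite le_min => /andP[tr ts]; split; [apply: HP|apply: HQ].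
Qed.

Lemma soon_imp (P Q : R -> Prop) :
  (forall t, 0 < t -> P t -> Q t) -> soon P -> soon Q.
Proof. by move=> PQ [r r0 HP]; exists r => // t t0 tr; apply/PQ/HP. Qed.

Lemma soon_ex P : soon P -> exists2 t, 0 < t & P t.
Proof. by move=> [r r0 HP]; exists r => //; apply: HP. Qed.

Lemma soon_all (T : eqType) (s : seq T) (P : T -> R -> Prop) :
  (forall i, i \in s -> soon (P i)) ->
  soon (fun t => forall i, i \in s -> P i t).
Proof.
elim: s => [|i s IHs] H; first by exists 1.
have Hi := H i (mem_head _ _).
have /IHs Hs : forall j, j \in s -> soon (P j).
  by move=> j js; apply: H; rewrite inE js orbT.
apply: soon_imp (soon_and Hi Hs) => t t0 [Pi Ps] j.
by rewrite inE => /predU1P[->|/Ps].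
Qed.

Lemma soon_le r : 0 < r -> soon (fun t => t <= r).
Proof. by move=> r0; exists r. Qed.

Lemma soon_lt (b c d : R) : b < c -> soon (fun t => b < c + t * d).
Proof.
move=> bc; have d0 : 0 < `|d| + 1 by rewrite ltr_wpDl.
exists ((c - b) / (`|d| + 1)); first by rewrite divr_gt0 ?subr_gt0.
move=> t t0; rewrite ler_pdivlMr // => le.
have := ler_norm (- d); rewrite normrN => nd.
have : t * - d <= t * `|d| by rewrite ler_pM2l.
by move: le; rewrite mulrDr mulr1 mulrN; lra.
Qed.

(** An affine function of [t] settles on one side of [b]. Hence a germ of a ray is eventually inside
    or eventually outside a given polyhedron. *)
Lemma soon_half (b c d : R) :
  soon (fun t => c + t * d <= b) \/ soon (fun t => b < c + t * d).
Proof.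
have [cb|cb|->] := ltgtP c b.
- left; have := @soon_lt (- b) (- c) (- d); rewrite ltrN2 => /(_ cb).
  by apply: soon_imp => t _; rewrite mulrN; lra.
- by right; apply: soon_lt.
- have [d0|d0] := leP d 0; [left|right]; exists 1 => // t t0 _.
    by rewrite gerDl pmulr_rle0.
  by rewrite ltrDl mulr_gt0.
Qed.

Lemma dotDZ (V : finType) (a x u : pt V) t :
  dot a (x + t *: u) = dot a x + t * dot a u.
Proof. by rewrite linearD linearZ. Qed.

Lemma soon_polyhedron (V : finType) (C : polyhedron R V) (x u : pt V) :
  soon (fun t => in_polyhedron C (x + t *: u)) \/
  soon (fun t => ~ in_polyhedron C (x + t *: u)).
Proof.
have [H|] := pselect (forall h, h \in C ->
    soon (fun t => dot h.1 x + t * dot h.1 u <= h.2)).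
  left; apply: soon_imp (soon_all H) => t _ Ht h /Ht.
  by rewrite -dotDZ.
move=> /existsNP[h /not_implyP[hC nh]]; right.
have [//|] := soon_half h.2 (dot h.1 x) (dot h.1 u).
by apply: soon_imp => t _ lt /(_ _ hC); rewrite [X in X <= _ -> _]dotDZ leNgt lt.
Qed.

Lemma polyhedron_closed (V : finType) (C : polyhedron R V) (x u : pt V) :
  soon (fun t => in_polyhedron C (x + t *: u)) -> in_polyhedron C x.
Proof.
move=> HC h hC; rewrite leNgt; apply/negP => lt.
have [t t0 [lt' /(_ _ hC)]] := soon_ex (soon_and (soon_lt (dot h.1 u) lt) HC).
by rewrite [X in X <= _ -> _]dotDZ leNgt lt'.
Qed.

Lemma polyhedron_convex (V : finType) (C : polyhedron R V) (x u : pt V) r t :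
  in_polyhedron C x -> in_polyhedron C (x + r *: u) -> 0 < t -> t <= r ->
  in_polyhedron C (x + t *: u).
Proof.
move=> Cx Cr t0 tr h hC; have := Cx h hC; have := Cr h hC.
rewrite -/(dot h.1 x) -/(dot h.1 (x + r *: u)) -/(dot h.1 (x + t *: u)) !dotDZ.
have [d0|d0] := leP (dot h.1 u) 0.
  have : t * dot h.1 u <= 0 by rewrite pmulr_rle0.
  by lra.
have : t * dot h.1 u <= r * dot h.1 u by rewrite ler_pM2r.
by lra.
Qed.

(** Only the inequalities tight at [x] restrict the direction; the strict ones hold for a while
    anyway. *)
Lemma soon_in_polyhedron (V : finType) (C : polyhedron R V) (x u : pt V) :
  in_polyhedron C x ->
  (forall h, h \in C -> dot h.1 x = h.2 -> dot h.1 u <= 0) ->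
  soon (fun t => in_polyhedron C (x + t *: u)).
Proof.
move=> Cx Cu.
have /soon_all : forall h, h \in C ->
    soon (fun t => dot h.1 (x + t *: u) <= h.2).
  move=> h hC; have := Cx h hC; rewrite -/(dot h.1 x) le_eqVlt.
  case/predU1P => [E|lt].
    by exists 1 => // t t0 _; rewrite dotDZ E gerDl pmulr_rle0 // Cu.
  have := @soon_lt (- h.2) (- dot h.1 x) (- dot h.1 u); rewrite ltrN2 => /(_ lt).
  by apply: soon_imp => t _; rewrite dotDZ mulrN; lra.
by apply: soon_imp => t _ H h /H.
Qed.

(** Otherwise the germ would eventually leave each of the finitely many pieces, hence all of them at
    one time. *)
Lemma germ_piece (V : finType) (D : pt V -> Prop) (Cs : seq (polyhedron R V))
    (x u : pt V) :
  (forall y, D y -> exists2 C, C \in Cs & in_polyhedron C y) ->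
  soon (fun t => D (x + t *: u)) ->
  exists2 C, C \in Cs & soon (fun t => in_polyhedron C (x + t *: u)).
Proof.
move=> cov HD; have [//|H] := pselect (exists2 C, C \in Cs &
  soon (fun t => in_polyhedron C (x + t *: u))).
have /soon_all HN : forall C, C \in Cs ->
    soon (fun t => ~ in_polyhedron C (x + t *: u)).
  move=> C CCs; have [HC|//] := soon_polyhedron C x u.
  by case: H; exists C.
have [t t0 [/cov[C CCs Ct] /(_ _ CCs)]] := soon_ex (soon_and HD HN).
by [].
Qed.

Lemma germ (V W : finType) (D : pt V -> Prop) (f : pt V -> pt W) (x u : pt V) :
  PL_on D f -> soon (fun t => D (x + t *: u)) ->
  exists b, soon (fun t => f (x + t *: u) = f x + t *: b).
Proof.
move=> [Cs [HD Hf]] Dx; have [|C CCs HC] := germ_piece (Cs := Cs) _ Dx.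
  by move=> y /HD.
have [A [b HA]] := affine_linP (Hf _ CCs); exists (A u).
have Cx := polyhedron_closed HC.
by apply: soon_imp HC => t t0 Ct; rewrite !HA // linearD linearZ addrAC.
Qed.

End Germs.

(** * Derivatives of PL maps at a vertex *)

Section Tangent.
Variable R : realType.
Local Notation pt := (point R).

(** The realization of the clique complex of [e]. *)
Definition flag (V : finType) (e : rel V) (x : pt V) : Prop :=
  cone e x /\ mass x = 1.

Definition link (V : finType) (e : rel V) (s : V) : rel V :=
  fun u v => [&& e u v, e u s, e v s, u != s & v != s].

Lemma link_sym (V : finType) (e : rel V) s : symmetric e -> symmetric (link e s).
Proof.
move=> es u v; rewrite /link es; congr (_ && _).
by rewrite andbCA; congr [&& _, _ & _]; rewrite andbC.
Qed.

(** A direction of mass 0: weight is moved from [s] to the link point [x], so [from s t x] keeps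
    mass 1. *)
Definition leave (V : finType) (s : V) (x : pt V) : pt V := x - mass x *: pole R s.

Definition from (V : finType) (s : V) (t : R) (x : pt V) : pt V :=
  pole R s + t *: leave s x.

Lemma link_cone0 (V : finType) (e : rel V) s (x : pt V) : cone (link e s) x -> x s = 0.
Proof.
move=> [_ ex]; have [//|xs] := eqVneq (x s) 0.
by have := ex _ _ xs xs; rewrite /link eqxx !andbF.
Qed.

Lemma from_other (V : finType) (s v : V) t (x : pt V) : v != s ->
  from s t x v = t * x v.
Proof. by move=> /negbTE vs; rewrite !ptE !ffunE vs add0r mulr0 subr0. Qed.

Lemma from_apex (V : finType) (s : V) t (x : pt V) : x s = 0 ->
  from s t x s = 1 - t * mass x.
Proof. by move=> xs; rewrite !ptE !ffunE eqxx xs sub0r mulr1 mulrN. Qed.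

Lemma from_mass (V : finType) (s : V) t (x : pt V) : mass (from s t x) = 1.
Proof.
by rewrite linearD linearZ linearB linearZ /= mass_pole mulr1 subrr mulr0 addr0.
Qed.

Lemma from_flag (V : finType) (e : rel V) s (x : pt V) : symmetric e -> e s s ->
  cone (link e s) x -> soon (fun t => flag e (from s t x)).
Proof.
move=> es ess ex; have xs := link_cone0 ex; case: ex => x0 ex.
have m0 := mass_ge0 x0.
exists (mass x + 1)^-1; first by rewrite invr_gt0 ltr_wpDl.
move=> t t0 tm; split; last exact: from_mass.
have tm1 : t * mass x <= 1.
  have : t * (mass x + 1) <= 1 by rewrite -ler_pdivlMr ?mul1r // ltr_wpDl.
  by rewrite mulrDr mulr1; lra.
have supp v : v != s -> from s t x v != 0 -> x v != 0.
  by move=> vs; rewrite from_other //; apply: contra_neq => ->; rewrite mulr0.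
split=> [v|u v].
  have [->|vs] := eqVneq v s; first by rewrite from_apex // subr_ge0.
  by rewrite from_other // mulr_ge0 // ltW.
have [->|us] := eqVneq u s; have [->|vs] := eqVneq v s => //.
- by move=> _ /(supp _ vs) xv; have /and5P[] := ex _ _ xv xv; rewrite es.
- by move=> /(supp _ us) xu; have /and5P[] := ex _ _ xu xu.
- by move=> /(supp _ us) xu /(supp _ vs) xv; have /and5P[] := ex _ _ xu xv.
Qed.

(** The one-sided derivative [d] of [f] at [s] is linear on the tangent cone of each piece through
    [s]. These cones are given by homogeneous inequalities, so [linearize] applies. *)
Lemma tangent (V W : finType) (e : rel V) (s : V) (f : pt V -> pt W) :
  symmetric e -> e s s -> PL_on (flag e) f ->
  exists (V' : finType) (e' : rel V') (phi : {linear pt V' -> pt V}) psi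
      (E : {linear pt V' -> pt W}),
    subdivision (link e s) e' phi psi /\
    forall x, cone e' x ->
      soon (fun t => f (from s t (phi x)) = f (pole R s) + t *: E x).
Proof.
move=> es ess PLf; have [Cs [HC Hf]] := PLf.
have /choice[d Hd] : forall x, exists b, cone (link e s) x ->
    soon (fun t => f (from s t x) = f (pole R s) + t *: b).
  move=> x; have [ex|nx] := pselect (cone (link e s) x); last by exists 0.
  have [b Hb] := germ PLf (from_flag es ess ex).
  by exists b.
have /choice[A HA] : forall C : polyhedron R V, exists A : {linear pt V -> pt W},
    C \in Cs -> exists b, forall x, in_polyhedron C x -> f x = A x + b.
  move=> C; have [/Hf/affine_linP[A HA]|_] := boolP (C \in Cs); first by exists A.
  by exists (mxlin (fun _ _ => 0)).
(* Only pieces containing the vertex count, and of these only the inequalities tight there,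
   collected in [CC]; [co] turns them into functionals on the link cone by composing with
   [leave]. *)
pose cs := [seq C <- Cs | `[< in_polyhedron C (pole R s) >]].
pose co (h : pt V) : pt V := [ffun v => h v - h s].
have coE h x : dot (co h) x = dot h (leave s x).
  rewrite linearB linearZ /= /dot; under eq_bigr do rewrite ffunE mulrBl.
  rewrite sumrB -mulr_sumr -/(mass x); congr (_ - _).
  by rewrite mulrC; have /= := dot_pole s h; rewrite /dot;
     under eq_bigr do rewrite mulrC; move=> ->.
pose CC (C : polyhedron R V) :=
  [seq co h.1 | h <- C & dot h.1 (pole R s) == h.2].
pose AA C : {linear pt V -> pt W} := mxlin (fun w v => A C (leave s (pole R v)) w).
have leaveL x : leave s x = \sum_v x v *: leave s (pole R v).
  rewrite /leave {1 2}(pole_sum x); under [RHS]eq_bigr do rewrite scalerBr.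
  rewrite sumrB; congr (_ - _); rewrite linear_sum scaler_suml.
  by apply: eq_bigr => v _; rewrite linearZ /= scalerA.
have AAE C x : AA C x = A C (leave s x).
  rewrite leaveL linear_sum; apply/ffunP => w; rewrite ffunE pt_sum.
  by apply: eq_bigr => v _; rewrite linearZ ptZ mulrC.
have [||V' [e' [phi [psi [E [S HE]]]]]] :=
  linearize (e := link e s) (f := d) (cs := cs) (C := CC) (A := AA)
    (link_sym s es).
- move=> x ex; have [|C CCs Cx] := germ_piece (Cs := Cs) _ (from_flag es ess ex).
    by move=> y /HC.
  exists C.
    by rewrite mem_filter CCs andbT; apply/asboolP; apply: polyhedron_closed Cx.
  move=> a /mapP[h]; rewrite mem_filter => /andP[/eqP hs hC] ->; rewrite coE.
  have [t t0 /(_ _ hC)] := soon_ex Cx.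
  by rewrite [X in X <= _ -> _]dotDZ hs gerDl pmulr_rle0.
- move=> C x; rewrite mem_filter => /andP[/asboolP Cs' CCs] ex tight.
  have [b Hb] := HA C CCs; rewrite AAE.
  have Cx : soon (fun t => in_polyhedron C (from s t x)).
    apply: soon_in_polyhedron => // h hC /eqP hs; rewrite -coE; apply: tight.
    by apply/mapP; exists h => //; rewrite mem_filter hs.
  have [t t0 [E Ct]] := soon_ex (soon_and (Hd x ex) Cx).
  move: E; rewrite !Hb // linearD addrAC linearZ => /addrI.
  by move=> /(scalerI (lt0r_neq0 t0)).
exists V', e', phi, psi, E; split=> // x ex; rewrite -HE //.
by apply: Hd; apply: sub_phi S _ ex.
Qed.

Definition std (U : finType) (y : pt U) : Prop :=
  (forall i, 0 <= y i) /\ mass y = 1.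

(* [Lam] and [Psi] identify the tangent cone of [L] at [p] with that of the
   simplex at [t0]. *)
Record chart (W U : finType) (L : pt W -> Prop) (p : pt W) (t0 : pt U)
    (Lam : {linear pt W -> pt U}) (Psi : pt U -> pt W) : Prop := {
  chart_std : forall x, L x -> std x;
  chart_center : std t0;
  chart_PL : PL_on (@std U) Psi;
  chart_in : soon (fun t => forall y, std y -> L (p + t *: Psi y));
  chart_K : forall y, std y -> Lam (Psi y) = y - t0;
  chart_dir : forall u, soon (fun t => L (p + t *: u)) ->
                soon (fun t => std (t0 + t *: Lam u));
  chart_inj : forall u v, soon (fun t => L (p + t *: u)) ->
     soon (fun t => L (p + t *: v)) -> Lam u = Lam v -> u = v
}.

(** At one fixed time [r] all points [p + r *: Psi y] lie in a standard simplex, which is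
    bounded. *)
Lemma chart_bounded (W U : finType) (L : pt W -> Prop) p (t0 : pt U) Lam Psi
    (a : pt W) : chart L p t0 Lam Psi ->
  exists M, forall y, std y -> `|dot a (Psi y)| <= M.
Proof.
move=> ch; have [r r0 Lr] := soon_ex (chart_in ch).
have stdE (x : pt W) : std x -> `|dot a x| <= \sum_v `|a v|.
  move=> [x0 x1]; apply: le_trans (ler_norm_sum _ _ _) _; apply: ler_sum => v _.
  rewrite normrM [`|x v|]ger0_norm ?x0 // ler_piMr //.
  by rewrite -x1 /mass (bigD1 v) //= lerDl sumr_ge0.
exists ((\sum_v `|a v| + `|dot a p|) / r) => y sy.
rewrite ler_pdivlMr // mulrC -[r in r * _](ger0_norm (ltW r0)) -normrM.
have := dotDZ a p (Psi y) r; have := stdE _ (chart_std ch (Lr _ sy)).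
move: (dot a _) => q qM qE.
have -> : r * dot a (Psi y) = q - dot a p by rewrite qE addrC addKr.
by apply: le_trans (ler_normB _ _) _; rewrite lerD2r.
Qed.

(** [Q] is the derivative of [f] read in the chart. For the section, fix [r] so small that every
    piece of [g] meeting an endpoint [p + r *: Psi y] contains [p]. By convexity [g] is then affine
    on the segment, whose image is a straight path [from s t (b y)]; evaluating [g] at the single
    time [r] makes [b] PL in [y]. *)
Lemma tangent_chart (V W U : finType) (e : rel V) (s : V) (L : pt W -> Prop)
    (f : pt V -> pt W) (g : pt W -> pt V) (t0 : pt U) Lam Psi :
  symmetric e -> e s s ->
  [/\ PL_on (flag e) f /\ PL_on L g, forall x, flag e x -> L (f x),
      forall y, L y -> flag e (g y), forall x, flag e x -> g (f x) = x
    & forall y, L y -> f (g y) = y] ->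
  chart L (f (pole R s)) t0 Lam Psi ->
  exists (V' : finType) (e' : rel V') (phi : {linear pt V' -> pt V}) psi
      (Q : {linear pt V' -> pt U}) (B : pt U -> pt V'),
    [/\ subdivision (link e s) e' phi psi,
        forall x, cone e' x -> soon (fun t => std (t0 + t *: Q x)),
        forall x y, cone e' x -> cone e' y -> Q x = Q y -> x = y,
        PL_on (@std U) B &
        forall y, std y -> cone e' (B y) /\ Q (B y) = y - t0].
Proof.
move=> es ess [[PLf PLg] fL gL gf fg] ch.
have [V' [e' [phi [psi [E [S HE]]]]]] := tangent es ess PLf.
set p := f (pole R s) in ch HE.
have flag_s : flag e (pole R s) by split; [apply: cone_pole | apply: mass_pole].
have gp : g p = pole R s by apply: gf.
have dirE x : cone e' x -> soon (fun t => L (p + t *: E x)).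
  move=> ex; have := from_flag es ess (sub_phi S ex).
  move=> /(soon_and (HE _ ex)); apply: soon_imp => t _ [<-]; exact: fL.
have [Ds [HD Hg]] := PLg.
(* A piece missing [p] violates some inequality strictly there, and the bound on [Psi] keeps it
   violated for a time independent of [y]. *)
have near C : C \in Ds -> soon (fun t => forall y, std y ->
    in_polyhedron C (p + t *: Psi y) -> in_polyhedron C p).
  move=> CDs; have [Cp|/existsNP[h /not_implyP[hC /negP]]] := pselect (in_polyhedron C p).
    by exists 1.
  rewrite -ltNge -/(dot h.1 p) => lt.
  have [M HM] := chart_bounded h.1 ch.
  apply: soon_imp (soon_lt (- M) lt) => t t0' lt' y sy /(_ _ hC).
  rewrite [X in X <= _ -> _]dotDZ leNgt => /negP[]; apply: lt_le_trans lt' _.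
  rewrite lerD2l ler_pM2l // lerNl; apply: le_trans (HM y sy).
  by rewrite -normrN ler_norm.
have [r r0 Hr] := soon_and (chart_in ch) (soon_all near).
have [Lr nearr] := Hr r r0 (lexx r).
pose z y := p + r *: Psi y.
pose pr : {linear pt V -> pt V} := mxlin (fun v u => ((u == v) && (v != s))%:R).
have prE x v : pr x v = (v != s)%:R * x v.
  rewrite ffunE (bigD1 v) //= eqxx big1 ?addr0 // => u /negbTE->.
  by rewrite mul0r.
pose b y := r^-1 *: pr (g (z y)).
have fromb y t : std y -> from s t (b y) = pole R s + (t / r) *: (g (z y) - pole R s).
  move=> sy; have [_ m1] := gL _ (Lr _ sy); rewrite -/(z y) in m1.
  rewrite /from -scalerA; congr (_ + t *: _).
  have prx : pr (g (z y)) = g (z y) - g (z y) s *: pole R s.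
    apply/ffunP => v; rewrite prE !ptE ffunE.
    by have [->|_] := eqVneq v s; rewrite ?mul0r ?mulr1 ?subrr // mul1r mulr0 subr0.
  have mb : mass (b y) = r^-1 * mass (pr (g (z y))) by rewrite linearZ.
  rewrite /leave mb -scalerA -scalerBr; congr (_ *: _).
  have -> : mass (pr (g (z y))) = 1 - g (z y) s.
    by rewrite prx massB massZ m1 mass_pole mulr1.
  rewrite prx scalerBl scale1r.
  by rewrite opprB addrA subrK.
have gb y t : std y -> 0 < t -> t <= r -> g (p + t *: Psi y) = from s t (b y).
  move=> sy t0' tr; have /HD[C CDs Cz] := Lr _ sy.
  have Cp : in_polyhedron C p by apply: nearr CDs _ sy Cz.
  have Ct : in_polyhedron C (p + t *: Psi y) by exact: polyhedron_convex Cp Cz t0' tr.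
  have [A [c HA]] := affine_linP (Hg _ CDs).
  have gE q : in_polyhedron C (p + q *: Psi y) ->
      g (p + q *: Psi y) = pole R s + q *: A (Psi y).
    by move=> Cq; rewrite -gp !HA // linearD linearZ addrAC.
  by rewrite fromb // /z !gE // addrAC subrr add0r scalerA divfK ?gt_eqF.
have eb y : std y -> cone (link e s) (b y).
  move=> sy; have [[x0 xe] _] := gL _ (Lr _ sy); rewrite -/(z y) in x0 xe.
  have bE v : b y v = r^-1 * ((v != s)%:R * g (z y) v) by rewrite ptZ prE.
  have supp v : b y v != 0 -> v != s /\ g (z y) v != 0.
    by rewrite bE; have [_|_] := eqVneq v s; rewrite ?mul0r ?mulr0 ?eqxx // mul1r;
      split=> //; apply: contraNneq H => ->; rewrite mulr0.
  have bs v : b y v != 0 -> e v s.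
    move=> bv; have [vs gv] := supp _ bv.
    (* At the endpoint the weight of [s] may be 0. Halfway it is at least 1/2, so the support there
       shows that [v] is adjacent to [s]. *)
    have r2 : 0 < r / 2 by rewrite divr_gt0.
    have r2r : r / 2 <= r by lra.
    have [[_ xe2] _] : flag e (from s (r / 2) (b y)).
      by rewrite -gb //; apply: gL; have [H _] := Hr _ r2 r2r; apply: H.
    apply: xe2; first by rewrite from_other // mulf_neq0 // gt_eqF.
    have -> : from s (r / 2) (b y) s = 1 + r / 2 / r * (g (z y) s - 1).
      by rewrite fromb // !ptE ffunE eqxx.
    have -> : r / 2 / r = 2^-1 by rewrite mulrAC divff ?mul1r // gt_eqF.
    by rewrite gt_eqF //; have := x0 s; lra.
  split=> [v|u v bu bv]; first by rewrite bE !mulr_ge0 // invr_ge0 ltW.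
  have [us gu] := supp _ bu; have [vs gv] := supp _ bv.
  by rewrite /link xe // !bs // us vs.
have EB y : std y -> E (psi (b y)) = Psi y.
  move=> sy; have ew := sub_psi S (eb y sy).
  have := soon_and (HE _ ew) (soon_and (soon_le r0) (chart_in ch)).
  move=> /soon_ex[t t0' [Et [tr Lt]]].
  move: Et; rewrite (sub_psiK S); last exact: eb.
  rewrite -gb // fg; last exact: Lt.
  by move=> /addrI/(scalerI (lt0r_neq0 t0')).
exists V', e', phi, psi, (Lam \o E), (psi \o b); split=> //.
- by move=> x /dirE/(chart_dir ch).
(* Equal derivatives give equal values of [f] at some small [t]; injectivity of [f] then recovers
   all coordinates off [s]. *)
- move=> x y ex ey /(chart_inj ch (dirE _ ex) (dirE _ ey)) Exy.
  rewrite -(sub_phiK S ex) -(sub_phiK S ey); congr psi.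
  have [ex' ey'] := (sub_phi S ex, sub_phi S ey).
  have := soon_and (from_flag es ess ex') (from_flag es ess ey').
  move=> /(soon_and (soon_and (HE _ ex) (HE _ ey)))/soon_ex.
  move=> [t t0' [[Ex Ey] [fx fy]]].
  have : from s t (phi x) = from s t (phi y).
    by rewrite -(gf _ fx) -(gf _ fy) Ex Ey Exy.
  move=> /ffunP xy; apply/ffunP => v; have [->|vs] := eqVneq v s.
    by rewrite !(link_cone0 (e := e)).
  have := xy v; rewrite !from_other //; apply: mulfI; exact: lt0r_neq0.
- apply: (PL_on_comp _ (sub_PL S)) => [|y sy]; last exact: eb.
  have zE : affine_on (fun _ : pt W => True) (fun x : pt W => p + r *: x : pt W).
    by apply: affineD (affine_cst _ _) _; apply: affineZ (affine_lin _ idfun).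
  have PLz : PL_on (@std U) z.
    exact: PL_on_comp (chart_PL ch) (PL_on_affine (polyhedralT _ _) zE) _.
  have PLgz : PL_on (@std U) (g \o z) by apply: PL_on_comp PLz PLg _ => y /Lr.
  have prA : affine_on (fun _ : pt V => True) (fun x => r^-1 *: pr x).
    by apply: affineZ; apply: affine_lin.
  exact: PL_on_comp PLgz (PL_on_affine (polyhedralT _ _) prA) _.
- move=> y sy; split; first by apply: sub_psi S _ (eb _ sy).
  by rewrite /= EB // (chart_K ch).
Qed.

End Tangent.

(** * Charts of the simplex and of its boundary *)

Section Charts.
Variable R : realType.
Local Notation pt := (point R).

Lemma realization_simplex d (x : pt 'I_d.+1) :
  realization (simplex d) x <-> std x.
Proof. by split=> [[x0 x1 _]|[x0 x1]]; split=> //; rewrite inE. Qed.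

Definition std_boundary (U : finType) (y : pt U) : Prop :=
  std y /\ exists i, y i = 0.

Lemma realization_boundary d (x : pt 'I_d.+1) :
  realization (simplex_boundary d) x <-> std_boundary x.
Proof.
split=> [[x0 x1]|[[x0 x1] [i xi]]].
  rewrite inE => /properP[_ [i _ xi]]; split=> //; exists i.
  by move: xi; rewrite inE negbK => /eqP.
split=> //; rewrite inE; apply/properP; split; first exact: subsetT.
by exists i; rewrite ?inE // xi eqxx.
Qed.

Lemma std_polyhedral (U : finType) : polyhedral (@std R U).
Proof.
apply: (polyhedral_ext (D := fun x => (cone (fun _ _ => true) x /\
    1 <= @mass R U x) /\ @mass R U x <= 1)).
  move=> x; split=> [[[[x0 _] m1] m2]|[x0 m1]].
    by split=> //; apply/eqP; rewrite eq_le m1 m2.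
  by rewrite m1.
apply: polyhedralI; last exact: polyhedral_half.
by apply: polyhedralI; [exact: cone_polyhedral | exact: polyhedral_half_ge].
Qed.

Lemma std_le1 (U : finType) (y : pt U) i : std y -> y i <= 1.
Proof. by move=> [y0 <-]; rewrite /mass (bigD1 i) //= lerDl sumr_ge0. Qed.

Lemma chart_simplex (W : finType) (p : pt W) : std p ->
  chart (@std R W) p p (idfun : {linear pt W -> pt W}) (fun y => y - p).
Proof.
move=> sp; split=> //.
- apply: PL_on_affine; first exact: std_polyhedral.
  by apply: affineB (affine_cst _ _); apply: (affine_lin _ idfun).
- exists 1 => // t t0 t1 y [y0 my]; have [p0 mp] := sp; split=> [i|].
    rewrite !ptE.
    have -> : p i + t * (y i - p i) = (1 - t) * p i + t * y i by ring.
    by rewrite addr_ge0 ?mulr_ge0 ?subr_ge0 // ltW.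
  by rewrite massD massZ massB my mp subrr mulr0 addr0.
Qed.

Definition const_pt (V : finType) (c : R) : pt V := [ffun=> c].

(** * The tangent cone of the boundary of a simplex at a point [p] *)

Section Boundary.
Variables (d : nat) (p : pt 'I_d.+2) (j k : 'I_d.+2).
Hypotheses (sp : std_boundary p) (pj : p j = 0) (pk : p k != 0).

Let Z := [set i | p i == 0].
(** Points from [p] into the interior: the zero coordinates of [p] rise at equal rate, at the
    expense of coordinate [k]. The tangent cone of the boundary consists of the directions of mass 0
    whose minimum over [Z] is 0, and it meets each line parallel to [q] of mass 0 exactly once. *)
Let q : pt 'I_d.+2 := [ffun i => (i \in Z)%:R - #|Z|%:R * (i == k)%:R].

Let kZ : k \notin Z. Proof. by rewrite inE. Qed.
Let jZ : j \in Z. Proof. by rewrite inE pj. Qed.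

Let qZ i : i \in Z -> q i = 1.
Proof.
move=> iZ; rewrite ffunE iZ; have [ik|_] := eqVneq i k.
  by have := kZ; rewrite -ik iZ.
by rewrite mulr0 subr0.
Qed.

Let q_ge i : - #|Z|%:R <= q i.
Proof.
rewrite ffunE lerBDl -[X in X <= _]addr0 addrC addrA.
have : (#|Z|%:R * (i == k)%:R : R) <= #|Z|%:R by rewrite ler_piMr // lern1 leq_b1.
have : 0 <= ((i \in Z)%:R : R) by [].
lra.
Qed.

Let mass_q : mass q = 0.
Proof.
rewrite /mass; under eq_bigr do rewrite ffunE.
rewrite sumrB -mulr_sumr (bigD1 k (F := fun i => (i == k)%:R)) //= eqxx.
rewrite [X in _ * (_ + X)]big1 ?addr0 ?mulr1 => [|i /negbTE-> //].
have -> : #|Z| = (\sum_i (i \in Z))%N.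
  by rewrite -sum1_card big_mkcond; apply: eq_bigr => i _; case: ifP.
by rewrite natr_sum subrr.
Qed.

(** Projection along [q] to the hyperplane where coordinate [j] vanishes; that coordinate is then
    dropped. *)
Let Lam : {linear pt 'I_d.+2 -> pt 'I_d.+1} :=
  mxlin (fun i w => (w == lift j i)%:R - (w == j)%:R * q (lift j i)).

Let LamE u i : Lam u i = u (lift j i) - u j * q (lift j i).
Proof.
rewrite ffunE; under eq_bigr do rewrite mulrBl -mulrA.
rewrite sumrB (bigD1 (lift j i)) //= eqxx mul1r big1 ?addr0; last first.
  by move=> w /negbTE->; rewrite mul0r.
rewrite (bigD1 j) //= eqxx mul1r big1 ?addr0 1?mulrC //.
by move=> w /negbTE->; rewrite mul0r.
Qed.

(** The barycentre: every direction of mass 0 stays in the simplex for a while. *)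
Let t0 : pt 'I_d.+1 := [ffun=> d.+1%:R^-1].

Let ext : {linear pt 'I_d.+1 -> pt 'I_d.+2} :=
  mxlin (fun w i => (w == lift j i)%:R).

Let ext_lift u i : ext u (lift j i) = u i.
Proof.
rewrite ffunE (bigD1 i) //= eqxx mul1r big1 ?addr0 // => i' ii'.
by rewrite (inj_eq lift_inj) eq_sym (negbTE ii') mul0r.
Qed.

Let ext_j u : ext u j = 0.
Proof. by rewrite ffunE big1 // => i _; rewrite (negbTE (neq_lift _ _)) mul0r. Qed.

Let massE (x : pt 'I_d.+2) : mass x = x j + \sum_i x (lift j i).
Proof. by rewrite /mass (bigD1_ord j). Qed.

Let x y := ext (y - t0).
(** Subtracting the minimum over [Z] times [q] brings that minimum to 0, hence lands in the tangent
    cone of the boundary. *)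
Let amin y : 'I_d.+2 := [arg min_(i < j | i \in Z) x y i]%O.
Let Psi y : pt 'I_d.+2 := x y - x y (amin y) *: q.

Let xE y i : x y i = ext y i - ext t0 i.
Proof. by rewrite /x linearB !ptE. Qed.

Let aminP y : amin y \in Z /\ forall i, i \in Z -> x y (amin y) <= x y i.
Proof. by rewrite /amin; case: Order.TotalTheory.arg_minP => // i iZ H; split. Qed.

Let mass_t0 : mass t0 = 1.
Proof.
rewrite /mass; under eq_bigr do rewrite ffunE.
by rewrite sumr_const card_ord -[_ *+ _]mulr_natr mulVf // pnatr_eq0.
Qed.

Let t0_gt0 i : 0 < t0 i. Proof. by rewrite ffunE invr_gt0 ltr0n. Qed.

Let mass_x y : std y -> mass (x y) = 0.
Proof.
move=> [_ my]; rewrite massE ext_j add0r; under eq_bigr do rewrite ext_lift.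
by rewrite -/(mass (y - t0)) massB my mass_t0 subrr.
Qed.

Let x_ge y i : std y -> -1 <= x y i.
Proof.
move=> [y0 my]; have [i' ->|->] := unliftP j i; last by rewrite ext_j; lra.
rewrite ext_lift !ptE; have := y0 i'.
have : t0 i' <= 1 by apply: std_le1; split=> // i0; apply: ltW.
lra.
Qed.

Let m_le0 y : x y (amin y) <= 0.
Proof. by have [_ /(_ _ jZ)] := aminP y; rewrite [x y j]ext_j. Qed.

Let PsiE y w : Psi y w = x y w - x y (amin y) * q w.
Proof. by rewrite !ptE. Qed.

Let Psi_Z y w : w \in Z -> 0 <= Psi y w.
Proof.
by move=> wZ; rewrite PsiE qZ // mulr1 subr_ge0; have [_] := aminP y; apply.
Qed.

(** The 1 bounds [x y w] from below; [#|Z|] bounds the correction, since the minimum lies between -1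
    and 0 and [q] is at least [- #|Z|]. A bound free of [y] yields one time for all [y] in
    [chart_in]. *)
Let Psi_ge y w : std y -> - (1 + #|Z|%:R) <= Psi y w.
Proof.
move=> sy; have := x_ge w sy; rewrite PsiE.
have := x_ge (amin y) sy; have := m_le0 y.
set m := x y (amin y) => m0 m1; have Z0 : 0 <= (#|Z|%:R : R) by [].
have : m * q w <= #|Z|%:R.
  have [q0|/ltW q0] := leP (q w) 0.
    rewrite -mulrNN; apply: le_trans (_ : 1 * - q w <= _).
      by rewrite ler_wpM2r; lra.
    by rewrite mul1r lerNl.
  by apply: le_trans Z0; apply: mulr_le0_ge0.
lra.
Qed.

Let dotB i i' (v : pt 'I_d.+2) : dot (pole R i - pole R i') v = v i - v i'.
Proof.
rewrite -!(dot_pole _ v) /dot -sumrB; apply: eq_bigr => w _.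
by rewrite !ptE mulrBl.
Qed.

Let far_coord_gt0 (u : pt 'I_d.+2) :
  soon (fun t => forall w, w \notin Z -> 0 < p w + t * u w).
Proof.
have [[p0 _] _] := sp.
have /soon_all : forall w, w \in [seq w <- enum 'I_d.+2 | w \notin Z] ->
    soon (fun t => 0 < p w + t * u w).
  move=> w; rewrite mem_filter inE => /andP[pw _]; apply: soon_lt.
  by rewrite lt_neqAle eq_sym pw p0.
by apply: soon_imp => t _ H w wZ; apply: H; rewrite mem_filter wZ mem_enum.
Qed.

(** Equal projections differ by a multiple of [q]. If [u j] were larger, [u] would be positive on
    all of [Z] and would leave the boundary for the interior. *)
Let dir_inj (u v : pt 'I_d.+2) :
  soon (fun t => std_boundary (p + t *: u)) ->
  soon (fun t => std_boundary (p + t *: v)) ->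
  Lam u = Lam v -> ~ v j < u j.
Proof.
move=> Hu Hv /ffunP uv lt.
have uvq w : u w = v w + (u j - v j) * q w.
  have [i ->|->] := unliftP j w; last by rewrite qZ //; ring.
  by have := uv i; rewrite !LamE; lra.
have vZ w : w \in Z -> 0 <= v w.
  rewrite inE => /eqP pw; have [t t_gt0 [[/(_ w) H _] _]] := soon_ex Hv.
  by move: H; rewrite !ptE pw add0r pmulr_rge0.
have [t t_gt0 [[_ [w E]] H]] := soon_ex (soon_and Hu (far_coord_gt0 u)).
rewrite !ptE in E; have [wZ|/H] := boolP (w \in Z); last by rewrite E ltxx.
have : 0 < u w by rewrite uvq qZ //; have := vZ w wZ; lra.
move: E; have := wZ; rewrite inE => /eqP->; rewrite add0r => /eqP.
by rewrite mulf_eq0 gt_eqF //= => /eqP->; rewrite ltxx.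
Qed.

Lemma chart_boundary_at : chart (@std_boundary 'I_d.+2) p t0 Lam Psi.
Proof.
have [[p0 mp] _] := sp.
split.
- by move=> y [].
- by split=> // i; apply: ltW.
(* One piece for each index [i] attaining the minimum. *)
- apply: (PL_on_cover (s := enum Z) (E := fun i y => std y /\
    forall i', i' \in enum Z ->
      (dot (pole R i - pole R i') \o ext) y <= dot (pole R i - pole R i') (ext t0))).
    move=> y; split=> [sy|[i _ []//]]; exists (amin y).
      by rewrite mem_enum; have [] := aminP y.
    split=> // i'; rewrite mem_enum => iZ.
    by have [_ /(_ _ iZ)] := aminP y; rewrite /= !dotB !xE; lra.
  move=> i iZ; pose G : {linear pt 'I_d.+2 -> pt 'I_d.+2} :=
    mxlin (fun w v => (v == w)%:R - (v == i)%:R * q w).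
  have GE v : G v = v - v i *: q.
    apply/ffunP => w; rewrite !ptE ffunE.
    under eq_bigr do rewrite mulrBl -mulrA.
    rewrite sumrB (bigD1 w) //= eqxx mul1r big1 ?addr0; last first.
      by move=> ? /negbTE->; rewrite mul0r.
    rewrite (bigD1 i) //= eqxx mul1r big1 ?addr0 1?mulrC //.
    by move=> ? /negbTE->; rewrite mul0r.
  apply: (PL_on_ext (D := fun y => std y /\
    forall i', i' \in enum Z ->
      (dot (pole R i - pole R i') \o ext) y <= dot (pole R i - pole R i') (ext t0))
    (f := fun y => (G \o ext) y - G (ext t0))) => //.
    move=> y [sy H]; rewrite /= -linearB -linearB GE /Psi -/(x y).
    suff -> : x y (amin y) = x y i by [].
    have [aZ /(_ i)] := aminP y; rewrite -mem_enum => /(_ iZ) le.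
    apply/le_anti; rewrite le /=.
    by have := H (amin y); rewrite mem_enum => /(_ aZ); rewrite /= !dotB !xE; lra.
  apply: PL_on_affine; last by apply: affineB (affine_lin _ _) (affine_cst _ _).
  apply: polyhedralI; first exact: std_polyhedral.
  by apply: polyhedral_all => i'; apply: polyhedral_half.
- have H := far_coord_gt0 (const_pt _ (- (1 + #|Z|%:R))).
  apply: soon_imp H => t t_gt0 H y sy; split; last first.
    exists (amin y); have [aZ _] := aminP y; rewrite !ptE qZ // mulr1 subrr mulr0.
    by move: aZ; rewrite inE addr0 => /eqP.
  split=> [w|]; last by rewrite massD massZ massB massZ mass_q mass_x // mp; ring.
  rewrite ptD ptZ; have [wZ|wZ] := boolP (w \in Z).
    by rewrite addr_ge0 // mulr_ge0 ?Psi_Z // ltW.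
  have := H w wZ; rewrite ffunE => lt; apply/ltW/(lt_le_trans lt).
  by rewrite lerD2l ler_pM2l // Psi_ge.
- move=> y sy; apply/ffunP => i; rewrite LamE /Psi !ptE ext_lift ext_j.
  rewrite (qZ jZ) !ptE; ring.
- move=> u Hu; have mu : mass u = 0.
    have [t t_gt0 [[_ m] _]] := soon_ex Hu.
    move: m; rewrite massD massZ mp => /(canRL (addKr _)); rewrite addNr => /eqP.
    by rewrite mulf_eq0 gt_eqF // => /eqP.
  have mL : mass (Lam u) = 0.
    rewrite /mass; under eq_bigr do rewrite LamE.
    rewrite sumrB -mulr_sumr.
    have := massE u; have := massE q; rewrite mu mass_q (qZ jZ) => e1 e2.
    have -> : \sum_i q (lift j i) = -1 by lra.
    have -> : \sum_i u (lift j i) = - u j by lra.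
    ring.
  have := soon_all (s := enum 'I_d.+1) (fun i _ => soon_lt (Lam u i) (t0_gt0 i)).
  apply: soon_imp => t t_gt0 H; split=> [i|].
    by rewrite !ptE ltW // H // mem_enum.
  by rewrite massD massZ mL mulr0 addr0.
- move=> u v Hu Hv uv; have [lt|lt|E] := ltgtP (v j) (u j).
  + by case: (dir_inj Hu Hv uv).
  + by case: (dir_inj Hv Hu (esym uv)).
  apply/ffunP => w; have [i ->|-> //] := unliftP j w.
  by have /ffunP/(_ i) := uv; rewrite !LamE E; lra.
Qed.

End Boundary.

Lemma chart_boundary d (p : pt 'I_d.+2) : std_boundary p ->
  exists (t0 : pt 'I_d.+1) Lam Psi,
    chart (@std_boundary 'I_d.+2) p t0 Lam Psi /\ forall i, 0 < t0 i.
Proof.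
move=> sp; have [[_ mp] [j pj]] := sp.
have [k pk] : exists k, p k != 0.
  apply: contrapT => /forallNP H; have /eqP := mp; rewrite /mass big1 => [|k _].
    by rewrite eq_sym oner_eq0.
  by have /negP := H k; rewrite negbK => /eqP.
do 3!eexists; split; first exact: chart_boundary_at sp pj pk.
by move=> i; rewrite ffunE invr_gt0 ltr0n.
Qed.

End Charts.

(** * Stars in balls and links in spheres *)

Section Gauge.
Variable R : realType.
Local Notation pt := (point R).

Section GaugeFunction.
Variables (U : finType) (t0 : pt U).
Hypothesis st0 : std t0.

(** Indices with [t0 i = 0] are left out of the maximum: there a tangent direction is non-negative
    and never meets the facet's bound. *)
Lemma gauge_exists : exists gz : pt U -> R, forall u,
  (exists2 i, t0 i != 0 & gz u = - u i / t0 i) /\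
  forall i, t0 i != 0 -> - u i / t0 i <= gz u.
Proof.
have [i0 ti0] : exists i, t0 i != 0.
  apply: contrapT => /forallNP H; have [_ /eqP] := st0; rewrite /mass big1 => [|k _].
    by rewrite eq_sym oner_eq0.
  by have /negP := H k; rewrite negbK => /eqP.
suff /choice[gz gzP] : forall u : pt U, exists c, (exists2 i, t0 i != 0 &
    c = - u i / t0 i) /\ forall i, t0 i != 0 -> - u i / t0 i <= c.
  by exists gz.
move=> u; pose i := [arg max_(i > i0 | t0 i != 0) (- u i / t0 i)]%O.
exists (- u i / t0 i); rewrite /i; case: Order.TotalTheory.arg_maxP => // j tj H.
by split=> //; exists j.
Qed.

Definition tangent_dir (u : pt U) := soon (fun t => std (t0 + t *: u)).

Lemma tangent_dir_mass u : tangent_dir u -> mass u = 0.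
Proof.
move=> /soon_ex[t t_gt0 [_ m]]; have [_ m0] := st0.
move: m; rewrite massD massZ m0 => /(canRL (addKr _)); rewrite addNr => /eqP.
by rewrite mulf_eq0 gt_eqF // => /eqP.
Qed.

Lemma tangent_dir_ge0 u i : tangent_dir u -> t0 i = 0 -> 0 <= u i.
Proof.
move=> /soon_ex[t t_gt0 [/(_ i) + _]] ti.
by rewrite !ptE ti add0r pmulr_rge0.
Qed.

Variable gz : pt U -> R.
Hypothesis gzP : forall u, (exists2 i, t0 i != 0 & gz u = - u i / t0 i) /\
  forall i, t0 i != 0 -> - u i / t0 i <= gz u.

Let t0_gt0 i : t0 i != 0 -> 0 < t0 i.
Proof. by move=> ti; have [/(_ i) ? _] := st0; rewrite lt_neqAle eq_sym ti. Qed.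

(** With gauge at most 0 all coordinates are non-negative; as their sum is 0, they vanish. *)
Lemma gauge_gt0 u : tangent_dir u -> u != 0 -> 0 < gz u.
Proof.
move=> Tu; apply: contraNT; rewrite -leNgt => g0.
have u0 i : 0 <= u i.
  have [|ti] := eqVneq (t0 i) 0; first exact: tangent_dir_ge0.
  have [_ /(_ i ti) le] := gzP u; have := le_trans le g0.
  by rewrite ler_pdivrMr ?t0_gt0 // mul0r oppr_le0.
apply/eqP/ffunP => i; rewrite pt0; apply/eqP; move: i (erefl true).
have := tangent_dir_mass Tu; rewrite /mass => /eqP; rewrite psumr_eq0 //.
by move=> /allP H i _; apply: H; rewrite mem_index_enum.
Qed.

Lemma gauge_std u : tangent_dir u -> std (t0 + u) <-> gz u <= 1.
Proof.
move=> Tu; have [[i ti gi] gm] := gzP u; split=> [[s0 _]|g1].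
  by rewrite gi ler_pdivrMr ?t0_gt0 // mul1r; have := s0 i; rewrite ptD; lra.
split; last by rewrite massD (tangent_dir_mass Tu) addr0; have [] := st0.
move=> j; rewrite ptD; have [tj|tj] := eqVneq (t0 j) 0.
  by rewrite tj add0r tangent_dir_ge0.
have := le_trans (gm j tj) g1; rewrite ler_pdivrMr ?t0_gt0 // mul1r; lra.
Qed.

End GaugeFunction.

(* The gauge [u |-> max_i (- u i / t0 i)] of the simplex at [t0] becomes linear
   on simplices once the differences of its branches are resolved; dividing each
   vertex by its gauge then maps the unit cone onto the simplex. *)
Lemma ball_of_chart (V U : finType) (e : rel V) (t0 : pt U)
    (Q : {linear pt V -> pt U}) (B : pt U -> pt V) :
  symmetric e -> std t0 ->
  (forall x, cone e x -> soon (fun t => std (t0 + t *: Q x))) ->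
  (forall x y, cone e x -> cone e y -> Q x = Q y -> x = y) ->
  PL_on (@std R U) B -> (forall y, std y -> cone e (B y) /\ Q (B y) = y - t0) ->
  exists (V' : finType) (e' : rel V') (phi : {linear pt V' -> pt V}) psi,
    subdivision e e' phi psi /\
    PL_iso (fun x => cone e' x /\ mass x <= 1) (@std R U).
Proof.
move=> es st0 dirQ injQ PLB HB.
have [gz gzP] := gauge_exists st0.
pose l (ij : U * U) : {scalar pt V} :=
  dot ((t0 ij.1)^-1 *: pole R ij.1 - (t0 ij.2)^-1 *: pole R ij.2) \o Q.
have lE ij x : l ij x = Q x ij.1 / t0 ij.1 - Q x ij.2 / t0 ij.2.
  rewrite /= /dot; under eq_bigr do rewrite !ptE mulrBl -!mulrA.
  rewrite sumrB -!mulr_sumr.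
  by have /= := dot_pole ij.1 (Q x); have /= := dot_pole ij.2 (Q x);
    rewrite /dot => -> ->; rewrite mulrC [_ * Q x ij.2]mulrC.
have [V' [e' [phi [psi [S res]]]]] := resolve_seq (enum {: U * U}) l es.
exists V', e', phi, psi; split=> //.
pose Q' : {linear pt V' -> pt U} := Q \o phi.
pose c v := gz (Q' (pole R v)).
have dirQ' x : cone e' x -> tangent_dir t0 (Q' x) by move=> /(sub_phi S)/dirQ.
have injQ' x y : cone e' x -> cone e' y -> Q' x = Q' y -> x = y.
  move=> ex ey /injQ E; rewrite -(sub_phiK S ex) -(sub_phiK S ey) E //;
  exact: sub_phi S _ _.
have cone0 : cone e' (0 : pt V') by split=> [v|u v]; rewrite !pt0 ?eqxx.
have c_gt0 v : e' v v -> 0 < c v.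
  move=> ev; have epv := cone_pole R ev.
  apply: (gauge_gt0 st0 gzP (dirQ' _ epv)); apply/eqP; rewrite -(linear0 Q').
  move=> /(injQ' _ _ epv cone0)/ffunP/(_ v)/eqP.
  by rewrite ffunE eqxx pt0 oner_eq0.
(* A branch [i] maximal at [x] is maximal at every vertex in the support of [x], because its
   differences with the other branches are resolved. *)
have gzQ x : cone e' x -> gz (Q' x) = \sum_v x v * c v.
  move=> ex; have [[i ti gi] gm] := gzP (Q' x).
  rewrite gi lin_coord -sumrN mulr_suml; apply: eq_bigr => v _.
  have [->|xv] := eqVneq (x v) 0; first by rewrite mulr0 oppr0 !mul0r.
  suff -> : c v = - Q' (pole R v) i / t0 i.
    by rewrite !mulNr mulrN mulrA [x v * _]mulrC.
  have [[j tj gj] gmv] := gzP (Q' (pole R v)).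
  apply/le_anti; rewrite gmv // andbT /c gj.
  have rij : resolved e' (l (i, j) \o phi) by apply: res; rewrite mem_enum.
  have : l (i, j) (phi x) <= 0 -> l (i, j) (phi (pole R v)) <= 0.
    exact: resolved_pole rij ex xv.
  rewrite !lE; have := gm j tj; rewrite gi /=; lra.
(* After this rescaling the mass of [x] is the gauge of its image, so mass at most 1 means lying in
   the simplex. *)
pose sc : {linear pt V' -> pt V'} := mxlin (fun v u => (u == v)%:R / c v).
pose cs : {linear pt V' -> pt V'} := mxlin (fun v u => (u == v)%:R * c v).
have scE x v : sc x v = x v / c v.
  rewrite ffunE (bigD1 v) //= eqxx big1 ?addr0 => [|u /negbTE->]; first by rewrite mul1r mulrC.
  by rewrite !mul0r.
have csE x v : cs x v = x v * c v.
  rewrite ffunE (bigD1 v) //= eqxx big1 ?addr0 => [|u /negbTE->]; first by rewrite mul1r mulrC.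
  by rewrite !mul0r.
have c0 (x : pt V') v : cone e' x -> x v != 0 -> 0 < c v.
  by move=> [_ ex] xv; apply/c_gt0/ex.
have scK (x : pt V') : cone e' x -> cs (sc x) = x.
  move=> ex; apply/ffunP => v; rewrite csE scE.
  by have [->|xv] := eqVneq (x v) 0; rewrite ?mul0r // divfK // gt_eqF // (c0 x).
have csK (x : pt V') : cone e' x -> sc (cs x) = x.
  move=> ex; apply/ffunP => v; rewrite scE csE.
  by have [->|xv] := eqVneq (x v) 0; rewrite ?mul0r // mulfK // gt_eqF // (c0 x).
have sce x : cone e' x -> cone e' (sc x).
  move=> ex; apply: (cone_sub ex) => v; rewrite scE; last by move=> ->; rewrite mul0r.
  have [->|xv] := eqVneq (x v) 0; first by rewrite mul0r.
  by rewrite divr_ge0 ?(cone_ge0 _ ex) // ltW // (c0 x).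
have cse x : cone e' x -> cone e' (cs x).
  move=> ex; apply: (cone_sub ex) => v; rewrite csE; last by move=> ->; rewrite mul0r.
  have [->|xv] := eqVneq (x v) 0; first by rewrite mul0r.
  by rewrite mulr_ge0 ?(cone_ge0 _ ex) // ltW // (c0 x).
have mcs x : cone e' x -> mass (cs x) = gz (Q' x).
  by move=> ex; rewrite gzQ //; apply: eq_bigr => v _; rewrite csE.
have B'e y : std y -> cone e' (psi (B y)).
  by move=> /HB[eB _]; apply: sub_psi S _ eB.
have QB y : std y -> Q' (psi (B y)) = y - t0.
  by move=> sy; have [eB QB] := HB y sy; rewrite /= (sub_psiK S eB).
exists (fun x => t0 + Q' (sc x)), (fun y => cs (psi (B y))); split.
- split.
    apply: PL_on_affine.
      by apply: polyhedralI; [exact: cone_polyhedral | exact: polyhedral_half].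
    exact: affineD (affine_cst _ _) (affine_lin _ (Q' \o sc)).
  have PLB' : PL_on (@std R U) (psi \o B).
    by apply: PL_on_comp PLB (sub_PL S) _ => y /HB[].
  by apply: (PL_on_comp (f := psi \o B) (g := cs) PLB' (PL_on_lin cs (polyhedralT _ _))).
- move=> x [ex m]; apply/(gauge_std st0 gzP (dirQ' _ (sce _ ex))).
  by rewrite -mcs ?scK //; apply: sce.
- move=> y sy; split; first exact/cse/B'e.
  rewrite mcs; last exact: B'e.
  rewrite QB //.
  apply/(gauge_std st0 gzP); last by rewrite addrC subrK.
  by rewrite -QB //; apply/dirQ'/B'e.
- move=> x [ex m]; set y := _ + _.
  have sy : std y.
    by apply/(gauge_std st0 gzP (dirQ' _ (sce _ ex))); rewrite -mcs ?scK //; apply: sce.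
  rewrite (injQ' (psi (B y)) (sc x)); [exact: scK|exact: B'e|exact: sce|].
  by rewrite QB // /y addrC addKr.
- move=> y sy; rewrite csK; last exact: B'e.
  by rewrite QB // addrC subrK.
Qed.

Definition star (V : finType) (e : rel V) (s : V) : rel V :=
  fun u v => [&& e u v, e u s & e v s].

(** Put the missing weight [1 - mass x] at [s]; forgetting the coordinate [s] is the inverse. *)
Lemma star_cone (V : finType) (e : rel V) s : symmetric e -> e s s ->
  PL_iso (fun x : pt V => cone (link e s) x /\ mass x <= 1) (flag (star e s)).
Proof.
move=> es ess.
have PLlink : polyhedral (fun x : pt V => cone (link e s) x /\ mass x <= 1).
  by apply: polyhedralI; [exact: cone_polyhedral | exact: polyhedral_half].
have PLstar : polyhedral (fun x : pt V => flag (star e s) x).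
  apply: (polyhedral_ext (D := fun x : pt V => (cone (star e s) x /\ 1 <= mass x)
      /\ mass x <= 1)).
    move=> x; split=> [[[ex m1] m2]|[ex ->] //].
    by split=> //; apply/le_anti; rewrite m1 m2.
  apply: polyhedralI; last exact: polyhedral_half.
  by apply: polyhedralI; [exact: cone_polyhedral | exact: polyhedral_half_ge].
pose pr : {linear pt V -> pt V} := mxlin (fun v u => ((u == v) && (v != s))%:R).
have prE x v : pr x v = (v != s)%:R * x v.
  rewrite ffunE (bigD1 v) //= eqxx big1 ?addr0 // => u /negbTE->.
  by rewrite mul0r.
have prs x : pr x = x - x s *: pole R s.
  apply/ffunP => v; rewrite prE !ptE ffunE.
  by have [->|_] := eqVneq v s; rewrite ?mul0r ?mulr1 ?subrr // mul1r mulr0 subr0.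
pose lv : {linear pt V -> pt V} := mxlin (fun v u => (leave s (pole R u)) v).
have lvE x : lv x = leave s x.
  apply/ffunP => v; rewrite ffunE /leave ptD ptN ptZ {2}/mass mulr_suml.
  rewrite {2}(pole_sum x) pt_sum -sumrB; apply: eq_bigr => u _.
  by rewrite !ptE mass_pole; ring.
exists (fun x => pole R s + lv x), pr; split.
- split; last exact: PL_on_lin.
  by apply: PL_on_affine => //; apply: affineD (affine_cst _ _) (affine_lin _ _).
- move=> x [ex m1]; have xs := link_cone0 ex; case: ex => x0 ex.
  have fE : pole R s + lv x = from s 1 x by rewrite lvE /from scale1r.
  rewrite fE; split; last exact: from_mass.
  have supp v : v != s -> from s 1 x v != 0 -> x v != 0.
    by move=> vs; rewrite from_other // mul1r.
  split=> [v|u v].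
    have [->|vs] := eqVneq v s; first by rewrite from_apex // mul1r subr_ge0.
    by rewrite from_other // mul1r.
  rewrite /star; have [->|us] := eqVneq u s; have [->|vs] := eqVneq v s.
  + by rewrite ess.
  + by move=> _ /(supp _ vs) xv; have /and5P[_ vs' _ _ _] := ex _ _ xv xv;
      rewrite ess vs' es vs'.
  + by move=> /(supp _ us) xu; have /and5P[_ us' _ _ _] := ex _ _ xu xu;
      rewrite ess us'.
  + by move=> /(supp _ us) xu /(supp _ vs) xv; have /and5P[-> -> ->] := ex _ _ xu xv.
- move=> y [[y0 ye] my]; have ys := y0 s; split; last first.
    by rewrite prs massB massZ my mass_pole mulr1 lerBlDr lerDl.
  split=> [v|u v]; first by rewrite prE mulr_ge0.
  have supp v' : pr y v' != 0 -> v' != s /\ y v' != 0.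
    by rewrite prE; have [_|_] := eqVneq v' s; rewrite ?mul0r ?eqxx // mul1r.
  move=> /supp[us yu] /supp[vs yv]; have /and3P[euv eus evs] := ye _ _ yu yv.
  by rewrite /link euv eus evs us vs.
- move=> x [ex m1]; have xs := link_cone0 ex; apply/ffunP => v.
  rewrite prE ptD lvE /leave !ptE ffunE.
  by have [->|_] := eqVneq v s; rewrite ?xs ?mul0r // mul1r mulr0 subr0 add0r.
- move=> y [_ my]; rewrite lvE prs /leave massB massZ my mass_pole mulr1.
  by apply/ffunP => v; rewrite !ptE; ring.
Qed.

Theorem star_ball (V : finType) (e : rel V) s d : symmetric e -> e s s ->
  PL_iso (flag e) (@std R 'I_d.+1) \/ PL_iso (flag e) (@std_boundary R 'I_d.+2) ->
  PL_iso (flag (star e s)) (@std R 'I_d.+1).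
Proof.
move=> es ess iso.
have flag_s : flag e (pole R s) by split; [apply: cone_pole | apply: mass_pole].
have [V' [e' [phi [psi [Q [B [t0 [st0 [S dirQ injQ PLB HB]]]]]]]]] :
    exists (V' : finType) (e' : rel V') (phi : {linear pt V' -> pt V}) psi
      (Q : {linear pt V' -> pt 'I_d.+1}) (B : pt 'I_d.+1 -> pt V')
      (t0 : pt 'I_d.+1), std t0 /\
    [/\ subdivision (link e s) e' phi psi,
        forall x, cone e' x -> soon (fun t => std (t0 + t *: Q x)),
        forall x y, cone e' x -> cone e' y -> Q x = Q y -> x = y,
        PL_on (@std R 'I_d.+1) B &
        forall y, std y -> cone e' (B y) /\ Q (B y) = y - t0].
  case: iso => -[f [g H]]; have [_ fL _ _ _] := H.
    have sp := fL _ flag_s.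
    have [V' [e' [phi [psi [Q [B HQ]]]]]] := tangent_chart es ess H (chart_simplex sp).
    by exists V', e', phi, psi, Q, B, (f (pole R s)).
  have sp := fL _ flag_s; have [t0 [Lam [Psi [ch _]]]] := chart_boundary sp.
  have [V' [e' [phi [psi [Q [B HQ]]]]]] := tangent_chart es ess H ch.
  by exists V', e', phi, psi, Q, B, t0; split=> //; apply: chart_center ch.
have [V'' [e'' [phi' [psi' [S' ball]]]]] := ball_of_chart (sub_sym S) st0 dirQ injQ PLB HB.
apply: PL_iso_trans ball; apply: PL_iso_sym.
apply: PL_iso_trans (star_cone es ess).
(* Subdivisions preserve mass, so this one restricts to the truncated cones. *)
have S2 := subdivision_trans S S'.
apply: (PL_iso_restrict (f := phi \o phi') (g := psi' \o psi)).
- split; [split|exact: sub_phi S2|exact: sub_psi S2|exact: sub_phiK S2|exact: sub_psiK S2].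
    exact: (PL_on_lin (phi \o phi')) (cone_polyhedral _ _).
  exact: sub_PL S2.
- exact: polyhedral_half.
- exact: polyhedral_half.
- by move=> x _; rewrite (sub_mass S2).
- by move=> x ex; rewrite -(sub_mass S2 (_ x)) (sub_psiK S2).
Qed.

(** At the interior point [t0] every direction has an opposite. A free face [T] with apex [v] would
    contradict this: from an inner point of the cone over [T] one can move towards [v], but nothing
    lies on the other side. *)
Theorem sphere_link_not_free (V : finType) (e : rel V) s d :
  symmetric e -> e s s -> PL_iso (flag e) (@std_boundary R 'I_d.+2) ->
  ~ free_face (link e s).
Proof.
move=> es ess [f [g H]] free; have [_ fL _ _ _] := H.
have flag_s : flag e (pole R s) by split; [apply: cone_pole | apply: mass_pole].
have [t0 [Lam [Psi [ch t0_gt0]]]] := chart_boundary (fL _ flag_s).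
have st0 := chart_center ch.
have [V' [e' [phi [psi [Q [B [S dirQ injQ PLB HB]]]]]]] := tangent_chart es ess H ch.
have [T [v [vT /cliqueP clT uniqT]]] := sub_free S free.
have es' := sub_sym S.
pose w0 : pt V' := [ffun u => (u \in T)%:R].
have ew0 : cone e' w0.
  split=> [u|u u']; rewrite !ffunE ?ler0n //.
  case uT: (u \in T); rewrite ?eqxx //; case uT': (u' \in T); rewrite ?eqxx //.
  by move=> _ _; apply: clT; rewrite inE ?uT ?uT' orbT.
have evv : e' v v by apply: clT; rewrite !inE eqxx.
have epv := cone_pole R evv.
have := soon_all (s := enum 'I_d.+1) (fun i _ => soon_lt (Q w0 i) (t0_gt0 i)).
move=> /(soon_and (dirQ _ ew0))/soon_ex[c c_gt0 [sy0 y0_gt0]].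
set y0 := t0 + c *: Q w0 in sy0.
have By0 : B y0 = c *: w0.
  have [eB QB] := HB _ sy0; apply: injQ => //; first exact: coneZ (ltW c_gt0) ew0.
  by rewrite QB /y0 linearZ addrC addKr.
have mQv := tangent_dir_mass st0 (dirQ _ epv).
(* All coordinates of [y0] are positive, so it may be moved against the direction of [v]. *)
have dirv : soon (fun t => std (y0 + t *: - Q (pole R v))).
  have /soon_all : forall i, i \in enum 'I_d.+1 ->
      soon (fun t => 0 < y0 i + t * (- Q (pole R v)) i).
    by move=> i iI; apply: soon_lt; rewrite ptD ptZ y0_gt0.
  apply: soon_imp => t t_gt0 Ht; split=> [i|].
    by rewrite ptD ptZ ltW // Ht // mem_enum.
  have [_ m0] := sy0; rewrite massD massZ m0.
  by rewrite -scaleN1r massZ mQv !mulr0 addr0.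
have [b Hb] := germ PLB dirv.
have /soon_all pos : forall u, u \in [seq u <- enum V' | u \in T] ->
    soon (fun t => 0 < (B y0) u + t * b u).
  move=> u; rewrite mem_filter => /andP[uT _]; apply: soon_lt.
  by rewrite By0 ptZ ffunE uT mulr1.
have [t t_gt0 [[sy Bt] Pt]] := soon_ex (soon_and (soon_and dirv Hb) pos).
have [ew1 Qw1] := HB _ sy; set w1 := B _ in ew1 Qw1 Bt.
have w1T u : u \in T -> w1 u != 0.
  by move=> uT; rewrite Bt ptD ptZ gt_eqF // Pt // mem_filter uT mem_enum.
(* The lifted point still charges all of [T]; by freeness its support can only gain [v]. *)
have w1supp u : w1 u != 0 -> u \in v |: T.
  move=> wu; rewrite !inE orbC; have [//|uT] := boolP (u \in T).
  case: ew1 => _ ew1; apply/eqP/uniqT => //; first exact: ew1.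
  by move=> w wT; apply: ew1 => //; apply: w1T.
have ew2 : cone e' (w1 + t *: pole R v).
  have [w1_ge0 _] := ew1; split=> [u|u u'].
    by rewrite ptD ptZ addr_ge0 // ffunE mulr_ge0 ?ler0n // ltW.
  have supp u'' : (w1 + t *: pole R v) u'' != 0 -> u'' \in v |: T.
    rewrite ptD ptZ ffunE; have [-> _|_] := eqVneq u'' v; first by rewrite !inE eqxx.
    by rewrite mulr0 addr0; apply: w1supp.
  by move=> /supp uT /supp uT'; apply: clT.
(* Adding [v] back undoes the move, so [Q] agrees on both points; yet only the left one has weight
   at [v]. *)
have : w1 + t *: pole R v = c *: w0.
  rewrite -By0; apply: injQ => //; first by have [] := HB _ sy0.
  have [_ ->] := HB _ sy0; rewrite linearD linearZ Qw1.
  by rewrite scalerN addrAC subrK.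
move=> /ffunP/(_ v); rewrite ptD !ptZ !ffunE eqxx (negbTE vT) mulr0 mulr1.
by have [/(_ v) w1v _] := ew1; lra.
Qed.

End Gauge.

(** * Moves on flag complexes *)

Section Flags.
Variable R : realType.
Local Notation pt := (point R).

Lemma mass_polyhedral (V : finType) (c : R) : polyhedral (fun x : pt V => mass x = c).
Proof.
have := polyhedralI (polyhedral_half (@mass R V) c) (polyhedral_half_ge (@mass R V) c).
apply: polyhedral_ext => x; split=> /= [[m1 m2]|->]; last by [].
by apply/le_anti; rewrite m1.
Qed.

Lemma subdivision_flag (V V' : finType) (e : rel V) (e' : rel V') phi psi :
  subdivision (R := R) e e' phi psi -> PL_iso (@flag R V e) (@flag R V' e').
Proof.
move=> S; apply: PL_iso_sym; apply: (PL_iso_restrict (f := phi) (g := psi)).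
- split; [split|exact: sub_phi S|exact: sub_psi S|exact: sub_phiK S|exact: sub_psiK S].
    exact: PL_on_lin (cone_polyhedral _ _).
  exact: sub_PL S.
- exact: mass_polyhedral.
- exact: mass_polyhedral.
- by move=> x _; rewrite (sub_mass S).
- by move=> x ex; rewrite -(sub_mass S (psi x)) (sub_psiK S).
Qed.

Lemma edge_sub_flag (V : finType) (e : rel V) a b :
  symmetric e -> a != b -> e a b -> e a a -> e b b ->
  PL_iso (@flag R V e) (@flag R _ (edge_sub e a b)).
Proof.
move=> es ab eab ea eb; apply: subdivision_flag.
by apply: (@edge_subdivision _ _ _ _ _ (2^-1)) => //; lra.
Qed.

Lemma flag_eq (V : finType) (e e' : rel V) : e =2 e' ->
  PL_iso (@flag R V e) (@flag R V e').
Proof.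
move=> ee; have -> : e' = e by apply/funext => u; apply/funext => v; rewrite ee.
have PL : PL_on (@flag R V e) (idfun : {linear pt V -> pt V}).
  by apply: PL_on_lin; apply: polyhedralI; [exact: cone_polyhedral|exact: mass_polyhedral].
by exists id, id.
Qed.

Section Relabel.
Variables (V V' : finType) (e : rel V) (e' : rel V') (r : V -> V') (r' : V' -> V).
Hypotheses (rK : forall v, e v v -> r' (r v) = v)
  (r'K : forall v, e' v v -> r (r' v) = v)
  (er : forall u v, e u v -> e' (r u) (r v))
  (er' : forall u v, e' u v -> e (r' u) (r' v)).

(** The factor [e' v' v'] clears labels that are not vertices, where [r'] is unconstrained. *)
Definition relabel : {linear pt V -> pt V'} :=
  mxlin (fun v' v => ((v == r' v') && e' v' v')%:R).

Lemma relabelE x v' : relabel x v' = (e' v' v')%:R * x (r' v').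
Proof.
rewrite ffunE (bigD1 (r' v')) //= eqxx big1 ?addr0 // => v /negbTE->.
by rewrite mul0r.
Qed.

Lemma relabel_flag x : flag e x -> flag e' (relabel x).
Proof.
move=> [[x0 ex] mx]; split; first split=> [v|u v].
- by rewrite relabelE mulr_ge0.
- rewrite !relabelE.
  case eu: (e' u u); rewrite ?mul0r ?eqxx //; case ev: (e' v v); rewrite ?mul0r ?eqxx //.
  by rewrite !mul1r => xu xv; rewrite -(r'K eu) -(r'K ev); apply/er/ex.
rewrite -mx /mass; under eq_bigr do rewrite relabelE.
rewrite [RHS](bigID (fun v => e v v)) /= [X in _ = _ + X]big1 ?addr0; last first.
  move=> v; have [//|xv] := eqVneq (x v) 0; by rewrite ex.
rewrite [RHS](reindex_onto r' r) => [|v /rK //]; rewrite [RHS]big_mkcond /=.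
apply: eq_bigr => v _; case ev: (e' v v).
  by rewrite er' // r'K // eqxx mul1r.
case: ifP; rewrite ?mul0r // => /andP[/er + /eqP rv].
by rewrite rv ev.
Qed.

End Relabel.

Lemma relabel_iso (V V' : finType) (e : rel V) (e' : rel V') (r : V -> V')
    (r' : V' -> V) :
  (forall v, e v v -> r' (r v) = v) -> (forall v, e' v v -> r (r' v) = v) ->
  (forall u v, e u v -> e' (r u) (r v)) ->
  (forall u v, e' u v -> e (r' u) (r' v)) ->
  PL_iso (@flag R V e) (@flag R V' e').
Proof.
move=> rK r'K er er'; exists (relabel e' r'), (relabel e r).
have PF (W : finType) (a : rel W) : polyhedral (@flag R W a).
  by apply: polyhedralI; [exact: cone_polyhedral | exact: mass_polyhedral].
split; first by split; apply: PL_on_lin.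
- exact: relabel_flag rK r'K er er'.
- exact: relabel_flag r'K rK er' er.
- move=> x [[_ ex] _]; apply/ffunP => v; rewrite !relabelE.
  have [ev|] := boolP (e v v); first by rewrite er // rK // !mul1r.
  by rewrite mul0r; have [//|xv] := eqVneq (x v) 0; rewrite ex.
- move=> x [[_ ex] _]; apply/ffunP => v; rewrite !relabelE.
  have [ev|] := boolP (e' v v); first by rewrite er' // r'K // !mul1r.
  by rewrite mul0r; have [//|xv] := eqVneq (x v) 0; rewrite ex.
Qed.

(** The new vertex is the crossing point of the diagonals [{a, b}] and [{c, d}]. The last two
    hypotheses say that both subdivisions yield the same graph: on the old vertices, and around the
    new one. *)
Lemma flip_iso (V : finType) (e1 e2 : rel V) a b c d :
  symmetric e1 -> symmetric e2 -> a != b -> c != d ->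
  e1 a b -> e1 a a -> e1 b b -> e2 c d -> e2 c c -> e2 d d ->
  (forall u v, e1 u v && ~~ ((u == a) && (v == b) || (u == b) && (v == a)) =
               e2 u v && ~~ ((u == c) && (v == d) || (u == d) && (v == c))) ->
  (forall v, e1 v a && e1 v b = e2 v c && e2 v d) ->
  PL_iso (@flag R V e1) (@flag R V e2).
Proof.
move=> s1 s2 ab cd eab eaa ebb ecd ecc edd H1 H2.
apply: PL_iso_trans (edge_sub_flag s1 ab eab eaa ebb) _.
apply: PL_iso_trans (PL_iso_sym (edge_sub_flag s2 cd ecd ecc edd)).
by apply: flag_eq => -[u|] [v|] /=.
Qed.

(** Its cliques are the chains in [A]: order complexes are flag complexes. *)
Definition comparability (disp : Order.disp_t) (P : finPOrderType disp)
    (A : {set P}) : rel P := fun u v => [&& u \in A, v \in A & (u >=< v)%O].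

Lemma comparability_sym (disp : Order.disp_t) (P : finPOrderType disp)
    (A : {set P}) : symmetric (comparability A).
Proof. by move=> u v; rewrite /comparability comparable_sym andbCA. Qed.

Lemma realization_order_complex (disp : Order.disp_t) (P : finPOrderType disp)
    (A : {set P}) x :
  @realization R P (order_complex A) x <-> flag (comparability A) x.
Proof.
split=> [[x0 mx]|[[x0 ex] mx]].
  rewrite inE => /andP[/subsetP sA /forall_inP cs]; split=> //; split=> // u v xu xv.
  have mu : u \in [set v | x v != 0] by rewrite inE.
  have mv : v \in [set v | x v != 0] by rewrite inE.
  by rewrite /comparability !sA //; have /forall_inP := cs u mu; apply.
split=> //; rewrite inE; apply/andP; split.
  by apply/subsetP => u; rewrite inE => xu; have /and3P[] := ex _ _ xu xu.
apply/forall_inP => u; rewrite inE => xu; apply/forall_inP => v; rewrite inE => xv.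
by have /and3P[] := ex _ _ xu xv.
Qed.

End Flags.

(** * Removable elements *)

Section Twins.
Context {disp : Order.disp_t} {P : finTBPOrderType disp}.
Local Open Scope order_scope.
Implicit Types (u v w x y z c : P).

(* [[x, \top]] is the product of [[x, c]] and the two-element chain, with
   [tau y] in the upper copy above [y]. *)
Record twin (x z c : P) (tau : P -> P) : Prop := {
  twin_xz : x < z;
  twin_below : forall w, w < z -> w <= x;
  twin_xc : x < c;
  twin_z : forall y, x <= y <= c -> z <= tau y;
  twin_onto : forall v, z <= v -> exists2 y, x <= y <= c & v = tau y;
  twin_mono : forall y y', x <= y <= c -> x <= y' <= c ->
    (tau y <= tau y') = (y <= y');
  twin_le : forall y y', x <= y <= c -> x <= y' <= c -> (y <= tau y') = (y <= y');
  twin_split : forall v, x <= v -> v <= c \/ z <= v;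
  twin_zc : ~~ (z <= c);
  twin_x : tau x = z;
  twin_c : tau c = \top
}.

Lemma exists_maximal (A : {set P}) : A != set0 ->
  exists2 y, y \in A & forall v, v \in A -> ~~ (y < v).
Proof.
case/set0Pn => w wA; pose card v := #|[set t : P | t <= v]|.
have [y yA ymax] := @arg_maxnP P w (mem A) card wA.
exists y => // v /ymax /=; rewrite leqNgt; apply: contra => yv.
apply: proper_card; apply/properP; split.
  by apply/subsetP => s; rewrite !inE => /le_trans; apply; apply: ltW.
by exists v; rewrite !inE // lt_geF.
Qed.

Lemma exists_cover w z : w < z -> exists2 v, w <= v & covers z v.
Proof.
move=> wz; have [|v] := @exists_maximal [set v | w <= v < z].
  by apply/set0Pn; exists w; rewrite inE lexx.
rewrite inE => /andP[wv vz] vmax; exists v => //; rewrite /covers vz.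
apply/forallP => t; apply/negP => /andP[vt tz].
by have := vmax t; rewrite inE tz (le_trans wv (ltW vt)) vt => /(_ isT).
Qed.

Lemma removable_twin z : removable z -> exists x c tau, twin x z c tau.
Proof.
move=> [ztop [x [zx uniq [c0 _ [phi [[psi phiK psiK] phi_le [uz uzE [uz1 uz2]]]]]]]].
have psi_le p q : (psi p <= psi q) = (p <= q) by rewrite -phi_le !psiK.
have I_up v : x <= v -> exists u : subinterval x \top, val u = v.
  move=> xv; have hv : x <= v <= \top by rewrite xv lex1.
  by exists (Sub v hv); rewrite SubK.
have I_ge (u : subinterval x \top) : x <= val u by have /andP[] := valP u.
have xc0 : x <= c0 by have /andP[xp pc] := valP (phi uz).1; apply: le_trans xp pc.
have tcP : x <= c0 <= c0 by rewrite xc0 lexx.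
pose tc : subinterval x c0 := Sub c0 tcP.
have le_tc (q : subinterval x c0) : q <= tc by rewrite -Order.le_val SubK; have /andP[] := valP q.
pose bt := (phi uz).1.
have bt_le (q : subinterval x c0) : bt <= q.
  by rewrite -Order.le_val /bt uz1; have /andP[] := valP q.
have phi_uz : phi uz = (bt, true) by rewrite [LHS]surjective_pairing uz2.
pose c := val (psi (tc, false)).
have uP (u : subinterval x \top) : (val u <= c) = ~~ (phi u).2.
  rewrite /c Order.le_val -phi_le psiK leEprod /= le_tc /=.
  by case: (phi u).2.
have zP (u : subinterval x \top) : (z <= val u) = (phi u).2.
  rewrite -uzE Order.le_val -phi_le phi_uz leEprod /= bt_le /=.
  by case: (phi u).2.
(* Off [[x, \top]] the value is the default [v]; only values on [[x, c]] matter. *)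
pose tau v := if insub v is Some u then val (psi ((phi (u : subinterval x \top)).1, true))
              else v.
have tauE (u : subinterval x \top) : tau (val u) = val (psi ((phi u).1, true)) by rewrite /tau valK.
have lo y : x <= y <= c -> exists2 u : subinterval x \top, val u = y &
    phi u = ((phi u).1, false).
  move=> /andP[xy yc]; have [u uy] := I_up y xy; exists u => //.
  by rewrite [LHS]surjective_pairing; congr (_, _); apply/negbTE; rewrite -uP uy.
exists x, c, tau.
have xz : x < z by case/andP: zx.
have zc : ~~ (z <= c) by rewrite zP psiK.
have bx : val (psi (bt, false)) = x.
  have [u ux] := I_up x (lexx x).
  have : val (psi (bt, false)) <= val u.
    by rewrite Order.le_val -phi_le psiK leEprod /= bt_le; case: (phi u).2.
  by rewrite ux => le; apply/le_anti; rewrite I_ge le.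
have xcle : x <= c by apply: I_ge.
split=> //.
- move=> w /exists_cover[v wv zv]; by rewrite -(uniq v zv).
- rewrite lt_neqAle xcle andbT; apply/eqP => xc.
  have /val_inj/(can_inj psiK)[tb] : val (psi (bt, false)) = val (psi (tc, false)).
    by rewrite bx; exact: xc.
  have [u ut] := I_up \top (lex1 x).
  have : val u <= val uz.
    by rewrite Order.le_val -phi_le phi_uz leEprod /= tb le_tc; case: (phi u).2.
  by rewrite ut uzE => le; case/eqP: ztop; apply/le_anti; rewrite lex1 le.
- move=> y /lo[u <- _]; by rewrite tauE zP psiK.
- move=> v zv; have [u uv] := I_up v (le_trans (ltW xz) zv).
  exists (val (psi ((phi u).1, false))); first by rewrite I_ge uP psiK.
  rewrite tauE psiK -uv; congr val; apply: (can_inj phiK); rewrite psiK.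
  by rewrite [LHS]surjective_pairing -[(phi u).2]zP uv zv.
- move=> _ _ /lo[u <- pu] /lo[u' <- pu']; rewrite !tauE !Order.le_val psi_le.
  by rewrite -phi_le pu pu' !leEprod.
- move=> _ _ /lo[u <- pu] /lo[u' <- pu']; rewrite tauE !Order.le_val -!phi_le psiK.
  by rewrite pu pu' !leEprod.
- move=> v /I_up[u <-]; rewrite uP zP; case: (phi u).2; by [right|left].
- by rewrite -[in tau x]bx tauE psiK -uzE -phi_uz phiK.
- have [u ut] := I_up \top (lex1 x).
  have : val u <= tau c.
    rewrite /c tauE psiK Order.le_val -phi_le psiK leEprod /= le_tc.
    by case: (phi u).2.
  by rewrite ut => le; apply/le_anti; rewrite lex1 le.
Qed.

End Twins.

(** * Removing a removable element *)

Section Moves.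
Variable R : realType.
Context {disp : Order.disp_t} {P : finTBPOrderType disp}.
Local Open Scope order_scope.
Variables (x z c : P) (tau : P -> P).
Hypothesis T : twin x z c tau.
Implicit Types (u v w y : P) (U : {set P}).

Let Q : {set P} := [set y | x < y < c].
Let Pp : {set P} := proper_part P.

Let xz : x < z := twin_xz T.
Let xc : x < c := twin_xc T.

Let PpE v : (v \in Pp) = (v != \bot) && (v != \top).
Proof. by rewrite !inE negb_or. Qed.

Let Q_lo y : y \in Q -> x <= y <= c.
Proof. by rewrite inE => /andP[/ltW-> /ltW->]. Qed.

Let c_lo : x <= c <= c. Proof. by rewrite ltW ?lexx. Qed.
Let x_lo : x <= x <= c. Proof. by rewrite lexx ltW. Qed.

Let c_neq_top : c != \top.
Proof. by apply: contraNneq (twin_zc T) => ->; apply: lex1. Qed.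

Let hi_not_lo y v : x <= y <= c -> v <= c -> ~~ (tau y <= v).
Proof.
move=> /(twin_z T) zy vc; apply: contra (twin_zc T) => yv.
exact: le_trans zy (le_trans yv vc).
Qed.

Let tau_inj y y' : x <= y <= c -> x <= y' <= c -> tau y = tau y' -> y = y'.
Proof.
move=> ly ly' E; apply/le_anti.
by rewrite -(twin_mono T ly ly') -(twin_mono T ly' ly) E lexx.
Qed.

Let cmp_tau y y' : x <= y <= c -> x <= y' <= c -> (tau y >=< tau y') = (y >=< y').
Proof. by move=> ly ly'; rewrite /Order.comparable !(twin_mono T). Qed.

Let cmp_lo_tau y y' : x <= y <= c -> x <= y' <= c -> (y >=< tau y') = (y <= y').
Proof.
move=> ly ly'; rewrite /Order.comparable (twin_le T) //.
by have /andP[_ yc] := ly; rewrite (negbTE (hi_not_lo ly' yc)) orbF.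
Qed.

Let cmp_z y : x < y -> y <= c -> ~~ (y >=< z).
Proof.
move=> xy yc; have zy : ~~ (z <= y).
  by rewrite -(twin_x T); apply: hi_not_lo yc.
rewrite /Order.comparable (negbTE zy) orbF; apply/negP => yz.
have : y < z by rewrite lt_neqAle yz andbT; apply: contraNneq zy => ->.
by move=> /(twin_below T); rewrite lt_geF.
Qed.

(** What is strictly below [z] is below [x], the only element that [z] covers; what is above [z] is
    above [x]. *)
Let cmp_z_x v : v >=< z -> v >=< x.
Proof.
case/orP; last first.
  by move=> zv; rewrite comparable_sym le_comparable // (le_trans (ltW xz)).
rewrite le_eqVlt => /predU1P[->|/(twin_below T)]; last exact: le_comparable.
by rewrite comparable_sym le_comparable // ltW.
Qed.

Let zQ : z \notin Q.
Proof. by apply/negP; rewrite inE => /andP[_ /ltW]; apply/negP/(twin_zc T). Qed.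
Let xQ : x \notin Q. Proof. by rewrite inE ltxx. Qed.
Let cQ : c \notin Q. Proof. by rewrite inE ltxx andbF. Qed.

Let tauU U y : U \subset Q -> x <= y <= c -> (tau y \in tau @: U) = (y \in U).
Proof.
move=> /subsetP UQ ly; apply/imsetP/idP => [[y' yU' E]|yU]; last by exists y.
by rewrite (tau_inj ly (Q_lo (UQ _ yU')) E).
Qed.

Let lo_tauU U v : U \subset Q -> v <= c -> v \notin tau @: U.
Proof.
move=> /subsetP UQ vc; apply/imsetP => -[y /UQ/Q_lo ly E].
by have := hi_not_lo ly vc; rewrite E lexx.
Qed.

Let tau_notQ y : x <= y <= c -> tau y \notin Q.
Proof.
move=> ly; apply/negP => /Q_lo/andP[_ le]; by have := hi_not_lo ly le; rewrite lexx.
Qed.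

Let z_tauU U : U \subset Q -> z \notin tau @: U.
Proof.
move=> UQ; rewrite -(twin_x T) tauU //; apply: contra xQ; exact: (subsetP UQ).
Qed.

(** The case distinction behind the comparisons of neighbourhoods. The missing upper copy, that of
    [c], is [\top]. *)
Variant place v : Prop :=
  | PlaceBelow of v <= x
  | PlaceZ of v = z
  | PlaceQ of v \in Q
  | PlaceC of v = c
  | PlaceTau y of y \in Q & v = tau y
  | PlaceAside of ~~ (v >=< x).

Let placeP v : v != \top -> place v.
Proof.
move=> vt; have [|vx] := boolP (v >=< x); last exact: PlaceAside.
case/orP=> [|xv]; first exact: PlaceBelow.
have lo_place y : x <= y <= c -> [\/ y = x, y = c | y \in Q].
  rewrite !le_eqVlt => /andP[/predU1P[->|xy]]; first by constructor 1.
  by case/predU1P=> [->|yc]; [constructor 2 | constructor 3; rewrite inE xy].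
have [vc|/(twin_onto T)[y ly E]] := twin_split T xv.
  have lv : x <= v <= c by rewrite xv.
  by case: (lo_place v lv) => [->|->|vQ];
    [exact: PlaceBelow | exact: PlaceC | exact: PlaceQ].
case: (lo_place y ly) => [yx|yc|yQ].
- by apply: PlaceZ; rewrite E yx (twin_x T).
- by rewrite E yc (twin_c T) eqxx in vt.
- exact: PlaceTau yQ E.
Qed.

Let cmpxx v : v >=< v. Proof. exact: comparablexx. Qed.

(* Interpolates between the subdivided order complex without [z] (for [U] empty)
   and the order complex with [z] (for [U] the whole interval [(x, c)]). *)
Definition flipped U : rel P := fun u v =>
  [&& u \in Pp, v \in Pp &
    if (u == z) && (v \in Q) || (v == z) && (u \in Q) then
      (u \notin U) && (v \notin U)
    else if (u == x) && (v \in tau @: Q) || (v == x) && (u \in tau @: Q) then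
      (u \in tau @: U) || (v \in tau @: U)
    else u >=< v].

Lemma flipped_sym U : symmetric (flipped U).
Proof.
move=> u v; rewrite /flipped comparable_sym.
rewrite [(u \in tau @: U) || _]orbC [(u \notin U) && _]andbC.
rewrite [(u == z) && _ || _]orbC [(u == x) && _ || _]orbC.
by rewrite andbCA.
Qed.

Let zP : z \in Pp.
Proof.
rewrite PpE (gt_eqF (le_lt_trans (le0x x) xz)) /=.
rewrite -(twin_x T) -(twin_c T); apply/eqP => /(tau_inj x_lo c_lo) E.
by have := xc; rewrite E ltxx.
Qed.

Let cP : c \in Pp.
Proof. by rewrite PpE c_neq_top (gt_eqF (le_lt_trans (le0x x) xc)). Qed.

Let QP y : y \in Q -> y \in Pp.
Proof.
rewrite inE PpE => /andP[xy yc].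
by rewrite (gt_eqF (le_lt_trans (le0x x) xy)) (lt_eqF (lt_le_trans yc (lex1 c))).
Qed.

Let tauP y : y \in Q -> tau y \in Pp.
Proof.
move=> yQ; have ly := Q_lo yQ; rewrite PpE -(twin_c T); apply/andP; split.
  by rewrite gt_eqF // (lt_le_trans _ (twin_z T ly)) // (le_lt_trans (le0x x) xz).
by apply: contraTneq yQ => /(tau_inj ly c_lo) ->.
Qed.

Let xzF : (x == z) = false. Proof. exact: lt_eqF. Qed.

Let tau_z y : y \in Q -> (tau y == z) = false.
Proof.
move=> yQ; apply/eqP; rewrite -(twin_x T) => /(tau_inj (Q_lo yQ) x_lo) E.
by have := xQ; rewrite -E yQ.
Qed.

Let tau_x y : x <= y <= c -> (tau y == x) = false.
Proof. by move=> ly; rewrite gt_eqF // (lt_le_trans xz (twin_z T ly)). Qed.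

Let tauQ y : y \in Q -> tau y \in tau @: Q. Proof. exact: imset_f. Qed.

(** The interval is filled from the top, by a maximal remaining [y] each time, so [U] stays an
    up-set of [Q]; the property is transported backwards from [Q]. *)
Lemma upset_ind (S : {set P} -> Prop) : S Q ->
  (forall U y, U \subset Q -> y \in Q -> y \notin U ->
    (forall u v, u \in U -> v \in Q -> u <= v -> v \in U) ->
    (forall v, v \in Q -> y < v -> v \in U) -> S (y |: U) -> S U) ->
  S set0.
Proof.
move=> SQ step.
suff H n U : (#|Q :\: U| <= n)%N -> U \subset Q ->
    (forall u v, u \in U -> v \in Q -> u <= v -> v \in U) -> S U.
  by apply: (H #|Q|); rewrite ?setD0 ?sub0set // => u v; rewrite inE.
elim: n U => [|n IHn] U le UQ up.
  suff -> : U = Q by [].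
  by apply/eqP; rewrite eqEsubset UQ -setD_eq0 -cards_eq0 -leqn0.
have [/eqP|/exists_maximal[y]] := eqVneq (Q :\: U) set0.
  by rewrite setD_eq0 => QU; suff -> : U = Q by []; apply/eqP; rewrite eqEsubset UQ.
rewrite inE => /andP[yU yQ] ymax.
have ymax' v : v \in Q -> y < v -> v \in U.
  move=> vQ yv; apply: contraT => vU.
  by have := ymax v; rewrite inE vU vQ yv => /(_ isT).
apply: (step U y) => //; apply: IHn.
- rewrite -ltnS; apply: leq_trans le; apply: proper_card; apply/properP; split.
    by apply: setDS; apply: subsetUr.
  by exists y; rewrite in_setD ?yU ?setU11.
- by rewrite subUset sub1set yQ.
- move=> u v; rewrite !in_setU1 => /predU1P[->|uU] vQ.
    by rewrite le_eqVlt eq_sym => /predU1P[->|/(ymax' _ vQ)->]; rewrite ?eqxx ?orbT.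
  by move=> uv; rewrite (up u v) ?orbT.
Qed.

(** * Flips, when [x] is not the minimum *)

Section NonzeroX.
Hypothesis x_neq_bot : x != \bot.

Let xP : x \in Pp.
Proof. by rewrite PpE x_neq_bot /= (lt_eqF (lt_le_trans xz (lex1 z))). Qed.

Let flipped_z U v : U \subset Q -> flipped U v z =
  (v \in Pp) && (if v \in Q then v \notin U else v >=< z).
Proof.
move=> UQ; have zU : z \notin U by apply: contra zQ; apply: (subsetP UQ).
rewrite /flipped zP (negbTE zQ) andbF eqxx /= zU andbT.
by rewrite (negbTE (z_tauU (subxx Q))) andbF eq_sym xzF.
Qed.

Let flipped_Q U v y : U \subset Q -> y \in Q -> flipped U v y =
  (v \in Pp) && (if v == z then y \notin U else v >=< y).
Proof.
move=> UQ yQ; have zU : z \notin U by apply: contra zQ; apply: (subsetP UQ).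
have yz : (y == z) = false by apply: contraNF zQ => /eqP<-.
have yx : (y == x) = false by apply: contraNF xQ => /eqP<-.
have yt : y \notin tau @: Q by apply: lo_tauU; have /andP[] := Q_lo yQ.
rewrite /flipped (QP yQ) yQ yz andbT orbF (negbTE yt) andbF yx /=.
by case: eqP => // ->; rewrite zU.
Qed.

Let flipped_x U v : U \subset Q -> flipped U v x =
  (v \in Pp) && (if v \in tau @: Q then v \in tau @: U else v >=< x).
Proof.
move=> UQ; have xt (V : {set P}) : V \subset Q -> x \notin tau @: V.
  by move=> VQ; apply: lo_tauU VQ (ltW xc).
rewrite /flipped xP (negbTE xQ) andbF xzF /= (negbTE (xt Q _)) // andbF eqxx /=.
by rewrite (negbTE (xt U UQ)) orbF.
Qed.

Let flipped_tau U v y : U \subset Q -> y \in Q -> flipped U v (tau y) =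
  (v \in Pp) && (if v == x then y \in U else v >=< tau y).
Proof.
move=> UQ yQ; have ly := Q_lo yQ.
rewrite /flipped tauP // (negbTE (tau_notQ ly)) andbF tau_z //= tauQ // andbT.
rewrite tau_x // orbF tauU //; case: eqP => // ->.
by rewrite (negbTE (lo_tauU UQ (ltW xc))).
Qed.

(** Adding [y] to [U] only removes the edge [{z, y}] and creates [{x, tau y}]; all other pairs are
    judged alike. *)
Let flipped_edges U y : U \subset Q -> y \in Q -> y \notin U -> forall u v,
  flipped U u v && ~~ ((u == z) && (v == y) || (u == y) && (v == z)) =
  flipped (y |: U) u v && ~~ ((u == x) && (v == tau y) || (u == tau y) && (v == x)).
Proof.
move=> UQ yQ yU; have ly := Q_lo yQ.
have U'Q : y |: U \subset Q by rewrite subUset sub1set yQ.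
have yz : (y == z) = false by apply: contraNF zQ => /eqP<-.
have nz (V : {set P}) : V \subset Q -> z \notin V.
  by move=> VQ; apply: contra zQ; apply: (subsetP VQ).
have nx (V : {set P}) : V \subset Q -> x \notin tau @: V.
  by move=> VQ; apply: lo_tauU VQ (ltW xc).
pose lhs u v := flipped U u v && ~~ ((u == z) && (v == y) || (u == y) && (v == z)).
pose rhs u v := flipped (y |: U) u v &&
  ~~ ((u == x) && (v == tau y) || (u == tau y) && (v == x)).
have lhsC u v : lhs u v = lhs v u.
  rewrite /lhs flipped_sym; congr (_ && ~~ _).
  by rewrite orbC ![(v == _) && _]andbC.
have rhsC u v : rhs u v = rhs v u.
  rewrite /rhs flipped_sym; congr (_ && ~~ _).
  by rewrite orbC ![(v == _) && _]andbC.
have caseQ v : v \in Q -> lhs z v = rhs z v.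
  move=> vQ; rewrite /lhs /rhs /flipped zP (QP vQ) eqxx vQ /= !nz //=.
  rewrite [z == x]eq_sym xzF [z == tau y]eq_sym tau_z // [z == y]eq_sym yz andbT.
  by rewrite !inE !negb_or /= andbT andbC.
have caseT v : v \in tau @: Q -> lhs x v = rhs x v.
  move=> vT; have /imsetP[w wQ vE] := vT; have lw := Q_lo wQ; have vP := tauP wQ.
  have vz := tau_z wQ; rewrite -vE in vP vz.
  have vy : (v == y) = false.
    by apply: contraTF vT => /eqP->; apply: lo_tauU => //; have /andP[] := ly.
  rewrite /lhs /rhs /flipped xP vP xzF vz vT eqxx vy !(negbTE (nx _ _)) //=.
  rewrite andbF andbT [x == tau y]eq_sym tau_x //= orbF vE !tauU //.
  have -> : (tau w == tau y) = (w == y).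
    by apply/eqP/eqP => [/(tau_inj lw ly)|->].
  by rewrite !inE; have [->|_] := eqVneq w y; rewrite ?(negbTE yU) ?andbT.
move=> u v; rewrite -/(lhs u v) -/(rhs u v).
have [/orP[] /andP[/eqP-> vQ]|nC1] := boolP ((u == z) && (v \in Q) || (v == z) && (u \in Q)).
- exact: caseQ.
- by rewrite lhsC rhsC caseQ.
have [/orP[] /andP[/eqP-> vT]|nC2] :=
  boolP ((u == x) && (v \in tau @: Q) || (v == x) && (u \in tau @: Q)).
- exact: caseT.
- by rewrite lhsC rhsC caseT.
rewrite /lhs /rhs /flipped (negbTE nC1) (negbTE nC2); congr (_ && _).
transitivity true; last apply/esym; apply/negP => /orP[] /andP[/eqP uE /eqP vE].
- by move: nC1; rewrite uE vE eqxx yQ.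
- by move: nC1; rewrite uE vE eqxx yQ orbT.
- by move: nC2; rewrite uE vE eqxx tauQ.
- by move: nC2; rewrite uE vE eqxx tauQ // orbT.
Qed.

(** The edge [{z, y}] before and [{x, tau y}] after have the same common neighbours. This needs the
    order of the flips: among elements comparable with [y], those outside [U] are at most [y], while
    those in [y |: U] are at least [y]. So both edges see the same part of each copy. *)
Lemma flipped_step U y : U \subset Q -> y \in Q -> y \notin U ->
  (forall u v, u \in U -> v \in Q -> u <= v -> v \in U) ->
  (forall v, v \in Q -> y < v -> v \in U) ->
  PL_iso (@flag R P (flipped U)) (@flag R P (flipped (y |: U))).
Proof.
move=> UQ yQ yU up ymax; have ly := Q_lo yQ.
have U'Q : y |: U \subset Q by rewrite subUset sub1set yQ.
have yz : (y == z) = false by apply: contraNF zQ => /eqP<-.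
have yc : y < c by move: yQ; rewrite inE => /andP[].
have ly' : x <= y by case/andP: ly.
have le_notU v : v <= y -> v \notin U.
  by move=> vy; apply: contra yU => vU; apply: up vU yQ vy.
apply: (@flip_iso _ _ _ _ z y x (tau y)); try exact: flipped_sym.
- by rewrite eq_sym yz.
- by rewrite eq_sym tau_x.
- by rewrite flipped_Q // zP eqxx yU.
- by rewrite flipped_z // zP (negbTE zQ) cmpxx.
- by rewrite flipped_Q // (QP yQ) yz cmpxx.
- by rewrite flipped_tau // xP eqxx !inE eqxx.
- by rewrite flipped_x // xP (negbTE (lo_tauU _ (ltW xc))) // cmpxx.
- by rewrite flipped_tau // tauP // tau_x // cmpxx.
- exact: flipped_edges.
move=> v; rewrite flipped_z // flipped_Q // flipped_x // flipped_tau //.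
have [vP|//] := boolP (v \in Pp); rewrite /=.
have vtop : v != \top by move: vP; rewrite PpE => /andP[].
have [vx|->|vQ|->|w wQ ->|vx] := placeP vtop.
- have vQ : v \notin Q by rewrite inE (le_gtF vx).
  have vt : v \notin tau @: Q by apply: lo_tauU (le_trans vx (ltW xc)).
  have vz : (v == z) = false by rewrite lt_eqF // (le_lt_trans vx).
  have [vz' vy vty] : [/\ v <= z, v <= y & v <= tau y].
    have vz' := le_trans vx (ltW xz).
    by split=> //; [exact: le_trans vx ly' | exact: le_trans vz' (twin_z T ly)].
  rewrite (negbTE vQ) (negbTE vt) vz (le_comparable vx) (le_comparable vz').
  by rewrite (le_comparable vy) (le_comparable vty) setU11 if_same.
- rewrite (negbTE zQ) (negbTE (z_tauU _)) // eqxx eq_sym xzF cmpxx yU /=.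
  by rewrite comparable_sym !le_comparable ?(ltW xz) ?(twin_z T).
- have lv := Q_lo vQ; have [xv vc] : x < v /\ v < c by move: vQ; rewrite inE => /andP[].
  have vz : (v == z) = false by apply: contraNF zQ => /eqP<-.
  rewrite vQ vz (negbTE (lo_tauU _ (ltW vc))) // (gt_eqF xv).
  rewrite comparable_sym [v >=< x]comparable_sym (le_comparable (ltW xv)) /=.
  rewrite cmp_lo_tau //; have [vy|] := boolP (v <= y).
    by rewrite le_notU // comparable_sym le_comparable.
  move=> nvy; apply/negP => /andP[vU]; rewrite /Order.comparable (negbTE nvy) orbF.
  move=> yv; case/negP: vU; apply: ymax => //; rewrite lt_neqAle yv andbT.
  by apply: contraNneq nvy => ->.
- rewrite (negbTE cQ) (negbTE (cmp_z xc _)) //= (negbTE (lo_tauU _ _)) //.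
  by rewrite (gt_eqF xc) cmp_lo_tau // (lt_geF yc) andbF.
- have lw := Q_lo wQ.
  rewrite (negbTE (tau_notQ lw)) tau_z // tauQ // tau_x // !tauU // cmp_tau //.
  rewrite comparable_sym le_comparable ?(twin_z T) //= comparable_sym cmp_lo_tau //.
  rewrite !inE; have [yw|nyw] := boolP (y <= w).
    rewrite comparable_sym le_comparable // andbT; have [->//|wy] := eqVneq w y.
    by rewrite ymax // lt_neqAle eq_sym wy.
  have [E|_] := eqVneq w y; first by rewrite E lexx in nyw.
  apply/esym/negP => /andP[wU]; rewrite /Order.comparable (negbTE nyw) orbF => wy.
  by case/negP: (le_notU _ wy).
- have vQ : v \notin Q.
    by apply: contra vx => /Q_lo/andP[xv _]; rewrite comparable_sym le_comparable.
  have vt : v \notin tau @: Q.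
    apply: contra vx => /imsetP[w /Q_lo lw ->]; rewrite comparable_sym le_comparable //.
    exact: le_trans (ltW xz) (twin_z T lw).
  have vz : v == z = false.
    by apply: contraNF vx => /eqP->; rewrite comparable_sym le_comparable // ltW.
  rewrite (negbTE vQ) (negbTE vt) (negbTE vx) /=; apply/negP => /andP[vcz _].
  by case/negP: vx; apply: cmp_z_x.
Qed.

(** The new vertex of [{x, c}] is adjacent to no upper copy of an element of [(x, c)], as [x] is in
    [flipped set0]. The old [x] has lost only [c] and keeps all of [Q], as [z] does there. *)
Lemma flipped_set0 :
  PL_iso (@flag R P (comparability (Pp :\ z))) (@flag R P (flipped set0)).
Proof.
set e := comparability _.
have PzE v : (v \in Pp :\ z) = (v != z) && (v \in Pp) by rewrite !inE.
have xPz : x \in Pp :\ z by rewrite PzE xzF xP.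
have cPz : c \in Pp :\ z.
  by rewrite PzE cP andbT; apply: contraTneq (twin_zc T) => ->; rewrite lexx.
have exc : e x c by rewrite /e /comparability xPz cPz le_comparable ?ltW.
have cpx v : v \in Pp :\ z -> e v v.
  by move=> vP; rewrite /e /comparability vP cmpxx.
apply: PL_iso_trans (edge_sub_flag R (comparability_sym _) _ exc _ _) _.
- by rewrite lt_eqF.
- exact: cpx.
- exact: cpx.
pose r o := if o is Some v then if v == x then z else v else x.
pose r' v := if v == x then None else if v == z then Some x else Some v.
have s0 : set0 \subset Q by apply: sub0set.
have f0 u v : flipped set0 u v = [&& u \in Pp, v \in Pp &
    if (u == z) && (v \in Q) || (v == z) && (u \in Q) then true
    else if (u == x) && (v \in tau @: Q) || (v == x) && (u \in tau @: Q) then false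
    else u >=< v].
  by rewrite /flipped imset0 !inE.
have zx : (z == x) = false by rewrite eq_sym.
have fx v : flipped set0 v x = (v \in Pp) && (v \notin tau @: Q) && (v >=< x).
  by rewrite flipped_x // imset0 in_set0 -andbA; case: (v \in tau @: Q).
have fz v : flipped set0 v z = (v \in Pp) && ((v \in Q) || (v >=< z)).
  by rewrite flipped_z // in_set0; case: (v \in Q).
have topP v : v \in Pp -> v != \top by rewrite PpE => /andP[].
have not_upper v : v \in Pp -> v >=< c -> v \notin tau @: Q.
  move=> vP vc; apply/imsetP => -[y yQ E]; move: vc; have ly := Q_lo yQ.
  rewrite E comparable_sym cmp_lo_tau //.
  by move: yQ; rewrite inE => /andP[_ yc]; rewrite lt_geF.
have cmp_x_z v : v \in Pp -> v != c -> v >=< x -> (v \in Q) || (v >=< z).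
  move=> /topP/placeP[vx|->|->//|->|y yQ ->|vx]; rewrite ?eqxx //.
  - by rewrite (le_comparable (le_trans vx (ltW xz))) orbT.
  - by rewrite cmpxx orbT.
  - by rewrite [_ >=< z]comparable_sym (le_comparable (twin_z T (Q_lo yQ))) orbT.
  - by rewrite (negbTE vx).
have cmp_x_c v : v \in Pp -> v != z -> v \notin tau @: Q -> v >=< x -> v >=< c.
  move=> /topP/placeP[vx|->|vQ|->|y yQ ->|vx]; rewrite ?eqxx ?cmpxx //.
  - by rewrite (le_comparable (le_trans vx (ltW xc))).
  - by have /andP[_ vc] := Q_lo vQ; rewrite [v >=< c]le_comparable.
  - by rewrite tauQ.
  - by rewrite (negbTE vx).
have cmp_z_neq_c v : (v \in Q) || (v >=< z) -> (v >=< x) && (v != c).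
  case/orP=> [vQ|vz].
    have /andP[xv _] := Q_lo vQ; rewrite comparable_sym le_comparable //=.
    by apply: contraTneq vQ => ->.
  rewrite cmp_z_x //=; apply: contraTneq vz => ->; exact: cmp_z.
have eE u v : e u v = [&& u \in Pp :\ z, v \in Pp :\ z & u >=< v] by [].
have cE u v : comparability (Pp :\ z) u v =
  [&& u \in Pp :\ z, v \in Pp :\ z & u >=< v] by [].
have r_x w : e w x && e w c -> flipped set0 (r (Some w)) x.
  rewrite !eE PzE => /andP[/and3P[/andP[_ wP] _ wx] /and3P[_ _ wc]].
  rewrite fx /r; case: eqP => _; last by rewrite wP not_upper.
  by rewrite zP (z_tauU (subxx _)) comparable_sym le_comparable // ltW.
have r_z w : w != x -> e x w -> w != c -> flipped set0 w z.
  rewrite eE !PzE => wx /and3P[_ /andP[_ wP] xw] wc.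
  by rewrite fz wP cmp_x_z // comparable_sym.
have r'_x v : flipped set0 v x -> edge_sub e x c (r' v) None.
  have cz : c != z by move: cPz; rewrite PzE => /andP[].
  rewrite fx /r' => /andP[/andP[vP vt] vx]; case: eqP => // _.
  case: eqP => [_|/eqP vz]; rewrite /= !eE !PzE xP cP xzF /=.
    by rewrite cmpxx (le_comparable (ltW xc)) cz.
  by rewrite vz vP vx cz cmp_x_c.
have r'_z v : v != x -> v != z -> flipped set0 v z ->
    edge_sub e x c (Some v) (Some x).
  rewrite fz => vx vz /andP[vP /cmp_z_neq_c/andP[cvx vc]] /=.
  by rewrite eE PzE vz vP xPz cvx (negbTE vx) (negbTE vc).
apply: (relabel_iso R (r := r) (r' := r')).
- move=> [v|]; last by rewrite /r' /r eqxx.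
  move=> /andP[/and3P[+ _ _] _]; rewrite PzE => /andP[vz _].
  by rewrite /r' /r; have [->|vx] := eqVneq v x;
    rewrite ?eqxx ?zx ?eqxx ?(negbTE vx) ?(negbTE vz).
- move=> v _; rewrite /r' /r; case: eqP => [->//|/eqP/negbTE vx].
  by case: eqP => [->|_]; rewrite ?eqxx ?vx.
- move=> [u|] [v|] uv; last by rewrite fx xP (lo_tauU _ (ltW xc)) // cmpxx.
  + move: uv; rewrite /= => /andP[uv nxc].
    have [ux|ux] := eqVneq u x; have [vx|vx] := eqVneq v x.
    * by rewrite fz zP cmpxx orbT.
    * rewrite flipped_sym; apply: r_z => //.
        by rewrite -ux.
      by apply: contraNneq nxc => ->; rewrite ux !eqxx.
    * apply: r_z => //.
        by rewrite -vx /e comparability_sym.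
      by apply: contraNneq nxc => ->; rewrite vx !eqxx orbT.
    * rewrite f0 (negbTE ux) (negbTE vx).
      case/and3P: uv; rewrite !PzE => /andP[/negbTE-> ->] /andP[/negbTE-> ->] ->.
      by [].
  + exact: r_x.
  + by rewrite flipped_sym; apply: r_x.
- move=> u v uv; have [ux|ux] := eqVneq u x.
    by rewrite ux edge_sub_sym ?{2}/r' ?eqxx; [apply: r'_x; rewrite flipped_sym -ux
      | exact: comparability_sym].
  have [vx|vx] := eqVneq v x.
    by rewrite vx {2}/r' eqxx; apply: r'_x; rewrite -vx.
  have [uz|uz] := eqVneq u z; have [vz|vz] := eqVneq v z.
  + by rewrite uz vz /r' zx eqxx /= cE xPz cmpxx (lt_eqF xc) andbF.
  + rewrite uz /r' zx eqxx (negbTE vx) (negbTE vz) edge_sub_sym; last exact: comparability_sym.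
    by apply: r'_z; rewrite // flipped_sym -uz.
  + by rewrite vz /r' zx eqxx (negbTE ux) (negbTE uz); apply: r'_z; rewrite // -vz.
  rewrite /r' (negbTE ux) (negbTE vx) (negbTE uz) (negbTE vz) /= cE !PzE uz vz.
  rewrite (negbTE ux) (negbTE vx) andbF andbT.
  by move: uv; rewrite f0 (negbTE ux) (negbTE uz) (negbTE vx) (negbTE vz).
Qed.

Lemma flippedQ : PL_iso (@flag R P (flipped Q)) (@flag R P (comparability Pp)).
Proof.
have zq y : y \in Q -> ~~ (y >=< z).
  by rewrite inE => /andP[xy /ltW yc]; apply: cmp_z.
have xq v : v \in tau @: Q -> x >=< v.
  case/imsetP => y /Q_lo ly ->; rewrite le_comparable //.
  exact: le_trans (ltW xz) (twin_z T ly).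
apply: flag_eq => u v; rewrite /flipped /comparability; do 2!congr (_ && _).
case: ifP => [/orP[] /andP[/eqP-> vQ]|_].
- by rewrite vQ andbF comparable_sym (negbTE (zq _ vQ)).
- by rewrite vQ (negbTE (zq _ vQ)).
case: ifP => // /orP[] /andP[/eqP-> vT].
- by rewrite vT orbT xq.
- by rewrite vT comparable_sym xq.
Qed.

Lemma remove_iso :
  PL_iso (@flag R P (comparability (Pp :\ z))) (@flag R P (comparability Pp)).
Proof.
apply: PL_iso_trans flipped_set0 _; apply: PL_iso_trans flippedQ.
apply: (upset_ind (S := fun U => PL_iso (flag (flipped U)) (flag (flipped Q)))).
  exact: flag_eq.
by move=> U y UQ yQ yU up ymax; apply: PL_iso_trans; apply: flipped_step.
Qed.

End NonzeroX.

(** * Welds, when [x] is the minimum *)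

Section ZeroX.
Hypothesis x_bot : x = \bot.

Let Pz : {set P} := Pp :\ z.

Let PzE v : (v \in Pz) = (v != z) && (v \in Pp).
Proof. by rewrite !inE. Qed.

Let PzD v (V : {set P}) : (v \in Pz :\: V) = (v \notin V) && (v \in Pz).
Proof. by rewrite [LHS]in_setD. Qed.

(** Now [P] is the whole product of [[x, c]] and the two-element chain, and both [x] and [\top] are
    improper. *)
Let placeE v : v \in Pz -> [\/ v \in Q, v = c | exists2 y, y \in Q & v = tau y].
Proof.
rewrite PzE PpE => /and3P[vz v0 /placeP[vx|vE|vQ|vc|y yQ E|vx]].
- by case/eqP: v0; apply/le_anti; rewrite le0x -x_bot vx.
- by rewrite vE eqxx in vz.
- by constructor 1.
- by constructor 2.
- by constructor 3; exists y.
- by case/negP: vx; rewrite x_bot comparable_sym le_comparable ?le0x.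
Qed.

Let cPz : c \in Pz.
Proof. by rewrite PzE cP andbT; apply: contraTneq (twin_zc T) => ->; rewrite lexx. Qed.

Let QPz y : y \in Q -> y \in Pz.
Proof. by move=> yQ; rewrite PzE QP // andbT; apply: contraNneq zQ => <-. Qed.

Let tauPz y : y \in Q -> tau y \in Pz.
Proof. by move=> yQ; rewrite PzE tauP // tau_z. Qed.

Let c_tau y : y \in Q -> (c >=< tau y) = false.
Proof.
move=> yQ; rewrite cmp_lo_tau //; last exact: Q_lo.
by move: yQ; rewrite inE => /andP[_ yc]; rewrite lt_geF.
Qed.

Let Q_c y : y \in Q -> y >=< c.
Proof. by move=> /Q_lo/andP[_ yc]; rewrite le_comparable. Qed.

(** Each [y] in [U] has been removed as the subdivision point of an edge [{c, tau y}], which appears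
    in its place. *)
Definition welded U : rel P := fun u v =>
  [&& u \in Pz :\: U, v \in Pz :\: U &
    [|| u >=< v, (u == c) && (v \in tau @: U) | (v == c) && (u \in tau @: U)]].

Lemma welded_sym U : symmetric (welded U).
Proof.
move=> u v; rewrite /welded comparable_sym [((u == c) && _) || _]orbC.
by rewrite andbCA.
Qed.

(** Subdividing [{c, tau y}] gives [y] back: the remaining neighbours of [y] are exactly the common
    neighbours of [c] and [tau y]. Everything above [y] in [Q] is already gone, so the rest of [Q]
    next to [y] lies below [tau y]; and [c] has been joined to the upper copies of just those
    elements. *)
Lemma welded_step U y : U \subset Q -> y \in Q -> y \notin U ->
  (forall u v, u \in U -> v \in Q -> u <= v -> v \in U) ->
  (forall v, v \in Q -> y < v -> v \in U) ->
  PL_iso (@flag R P (welded (y |: U))) (@flag R P (welded U)).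
Proof.
move=> UQ yQ yU up ymax; have ly := Q_lo yQ.
have U'Q : y |: U \subset Q by rewrite subUset sub1set yQ.
have notU (V : {set P}) v : V \subset Q -> v \notin Q -> v \notin V.
  by move=> VQ; apply: contra; apply: (subsetP VQ).
have yc : (y == c) = false by apply: contraNF cQ => /eqP<-.
have tc w : w \in Q -> (tau w == c) = false.
  by move=> wQ; apply/negP => /eqP E; have := c_tau wQ; rewrite E cmpxx.
have le_notU v : v <= y -> v \notin U.
  by move=> vy; apply: contra yU => vU; apply: up vU yQ vy.
have cD (V : {set P}) : V \subset Q -> c \in Pz :\: V by move=> VQ; rewrite PzD cPz notU.
have tD (V : {set P}) w : V \subset Q -> w \in Q -> tau w \in Pz :\: V.
  by move=> VQ wQ; rewrite PzD tauPz // notU // tau_notQ // Q_lo.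
have wcc : welded (y |: U) c c by rewrite /welded !cD // cmpxx.
have wtt : welded (y |: U) (tau y) (tau y) by rewrite /welded !tD // cmpxx.
have wct : welded (y |: U) c (tau y).
  by rewrite /welded cD // tD // eqxx imset_f ?setU11 ?orbT.
apply: PL_iso_trans (edge_sub_flag R (welded_sym _) _ wct wcc wtt) _.
  by rewrite eq_sym tc.
have comp_y v : v \in Pz -> v \notin U -> v != y ->
    welded (y |: U) v c && welded (y |: U) v (tau y) = (v >=< y).
  move=> vP vU vy; have vD : v \in Pz :\: (y |: U).
    by rewrite PzD vP in_setU1 negb_or vy vU.
  rewrite /welded vD cD // tD //= eqxx /= tc // orbF.
  case: (placeE vP) => [vQ|->|[w wQ ->]].
  - have lv := Q_lo vQ; have vc : (v == c) = false by apply: contraNF cQ => /eqP<-.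
    rewrite Q_c //= vc /= orbF cmp_lo_tau //; apply/idP/idP; first exact: le_comparable.
    case/orP => // yv; case/negP: vU; apply: ymax => //.
    by rewrite lt_neqAle eq_sym vy.
  - by rewrite cmpxx eqxx imset_f ?setU11 ?orbT // comparable_sym Q_c.
  have lw := Q_lo wQ.
  rewrite comparable_sym c_tau // tc //= tauU // in_setU1 cmp_tau // orbF.
  rewrite [RHS]comparable_sym cmp_lo_tau //; apply/andP/idP => [[]|yw].
    case/predU1P=> [->//|wU]; case/orP => // /le_notU; by rewrite wU.
  rewrite comparable_sym le_comparable //; split=> //.
  have [//|wy] := eqVneq w y; by rewrite ymax // lt_neqAle eq_sym wy.
pose r o := if o is Some v then v else y.
pose r' v := if v == y then None else Some v.
have weldS u v : u != y -> v != y ->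
    welded U u v = welded (y |: U) u v && ~~ ((u == c) && (v == tau y) || (u == tau y) && (v == c)).
  move=> uy vy.
  have DE w : w != y -> (w \in Pz :\: (y |: U)) = (w \in Pz :\: U).
    by move=> wy; rewrite !PzD in_setU1 negb_or wy.
  have tE w : w \in Pz -> (w \in tau @: U) = (w \in tau @: (y |: U)) && (w != tau y).
    move=> wP; rewrite imsetU1 in_setU1; have [->|_] := eqVneq w (tau y).
      by rewrite tauU // (negbTE yU).
    by rewrite andbT.
  rewrite /welded !DE //; have [uD|//] := boolP (u \in Pz :\: U).
  have [vD|//] := boolP (v \in Pz :\: U); rewrite /=.
  move: uD vD; rewrite !PzD => /andP[_ uP] /andP[_ vP]; rewrite (tE _ uP) (tE _ vP).
  have [uc|uc] := eqVneq u c; have [vc|vc] := eqVneq v c => /=.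
  - by rewrite uc vc cmpxx [c == tau y]eq_sym tc.
  - rewrite uc [c == tau y]eq_sym tc //= !orbF; case: eqP => [->|_].
      by rewrite c_tau // andbF.
    by rewrite !andbT.
  - rewrite vc andbT; case: eqP => [->|_]; last by rewrite !andbT.
    by rewrite comparable_sym c_tau // !andbF.
  - by rewrite andbF orbF andbT.
have weldy w : welded U w y = [&& w \in Pz, w \notin U & w >=< y].
  have yt : y \notin tau @: U by apply: lo_tauU UQ _; have /andP[] := ly.
  rewrite /welded !PzD (QPz yQ) yU yc (negbTE yt) !andbF !orbF /=.
  by rewrite andbCA andbA.
apply: (relabel_iso R (r := r) (r' := r')).
- move=> [v|] /=; last by rewrite /r' /r eqxx.
  move=> /andP[/and3P[+ _ _] _]; rewrite PzD in_setU1 negb_or /r' => /andP[/andP[vy _] _].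
  by rewrite (negbTE vy).
- by move=> v _; rewrite /r /r'; case: eqP.
- have r_y w : welded (y |: U) w c && welded (y |: U) w (tau y) -> welded U w y.
    move=> H; have := H; move=> /andP[/and3P[+ _ _] _].
    rewrite PzD in_setU1 negb_or => /andP[/andP[wy wU] wP].
    by rewrite weldy wP wU -comp_y.
  move=> [u|] [v|] //=.
  + move=> /andP[uv nct]; have /and3P[uD vD _] := uv.
    have ny w : w \in Pz :\: (y |: U) -> w != y.
      by rewrite PzD in_setU1 negb_or => /andP[/andP[]].
    by rewrite weldS ?ny // uv nct.
  + exact: r_y.
  + by move=> H; rewrite welded_sym; apply: r_y.
  + by rewrite weldy (QPz yQ) yU cmpxx.
- have r'_y v : v != y -> welded U v y -> edge_sub (welded (y |: U)) c (tau y) (Some v) None.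
    by move=> vy; rewrite weldy => /and3P[vP vU vcy]; rewrite /= comp_y.
  move=> u v uv; rewrite /r'; have [uy|uy] := eqVneq u y; have [vy|vy] := eqVneq v y.
  + by [].
  + by rewrite edge_sub_sym; [apply: r'_y; rewrite // welded_sym -uy|exact: welded_sym].
  + by apply: r'_y; rewrite // -vy.
  + by rewrite /= -weldS.
Qed.

Lemma welded_set0 : welded set0 =2 comparability Pz.
Proof. by move=> u v; rewrite /welded imset0 !in_set0 !andbF !orbF !setD0. Qed.

(** Only [c] and the upper copies remain, with [c] adjacent to all of them; in the star, [z] has
    this role. *)
Lemma weldedQ : PL_iso (@flag R P (welded Q)) (@flag R P (star (comparability Pp) z)).
Proof.
pose r v := if v == c then z else v; pose r' v := if v == z then c else v.
have zc : (z == c) = false by apply: contraNF (twin_zc T) => /eqP->.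
have PQ v : v \in Pz :\: Q -> v = c \/ exists2 y, y \in Q & v = tau y.
  by rewrite PzD => /andP[vQ /placeE[vQ'|->|vt]]; [rewrite vQ' in vQ|left|right].
have tc w : w \in Q -> (tau w == c) = false.
  by move=> wQ; apply/negP => /eqP E; have := c_tau wQ; rewrite E cmpxx.
have tD w : w \in Q -> tau w \in Pz :\: Q.
  by move=> wQ; rewrite PzD tauPz // tau_notQ // Q_lo.
have cD : c \in Pz :\: Q by rewrite PzD cPz cQ.
have z_tau w : w \in Q -> z >=< tau w by move=> /Q_lo lw; rewrite le_comparable ?(twin_z T).
have starP v : v \in Pp -> v >=< z -> v = z \/ exists2 y, y \in Q & v = tau y.
  move=> vP vz; have [->|vnz] := eqVneq v z; [by left|right].
  have vPz : v \in Pz by rewrite PzE vnz.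
  case: (placeE vPz) => // [vQ|vc].
    by move: vQ vz; rewrite inE => /andP[xv /ltW vc]; rewrite (negbTE (cmp_z xv vc)).
  by move: vz; rewrite vc (negbTE (cmp_z xc _)).
apply: (relabel_iso R (r := r) (r' := r')).
- move=> v /and3P[/PQ[->|[w wQ ->]] _ _]; rewrite /r /r'; first by rewrite !eqxx.
  by rewrite tc // tau_z.
- move=> v /and3P[/and3P[vP _ _] /and3P[_ _ vz] _]; rewrite /r /r'.
  by case: (starP v vP vz) => [->|[w wQ ->]]; rewrite ?eqxx // tau_z // tc.
- move=> u v /and3P[/PQ uE /PQ vE uv]; rewrite /r.
  have sE a b : star (comparability Pp) z a b =
     [&& a \in Pp, b \in Pp, a >=< b, a >=< z & b >=< z].
    rewrite /star /comparability zP /=.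
    by case: (a \in Pp); case: (b \in Pp); rewrite /= ?andbF.
  rewrite sE; case: uE vE uv => [->|[w wQ ->]] [->|[w' wQ' ->]] uv.
  + by rewrite eqxx zP cmpxx.
  + by rewrite eqxx tc // zP tauP // cmpxx ![_ >=< tau _]z_tau // comparable_sym z_tau.
  + by rewrite eqxx tc // zP tauP // cmpxx comparable_sym z_tau.
  rewrite !tc // !tauP // ![_ >=< z]comparable_sym !z_tau //= !andbT.
  by move: uv; rewrite !tc //= !orbF.
- move=> u v /and3P[/and3P[uP vP uv] /and3P[_ _ uz] /and3P[_ _ vz]]; rewrite /r'.
  case: (starP u uP uz) uv => [->|[w wQ ->]]; case: (starP v vP vz) => [->|[w' wQ' ->]].
  + by rewrite eqxx /welded cD cmpxx.
  + by rewrite eqxx tau_z // /welded cD tD // eqxx tauQ // orbT.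
  + by rewrite eqxx tau_z // /welded cD tD // eqxx tauQ // !orbT.
  by rewrite !tau_z // /welded !tD // => ->.
Qed.

Lemma remove_star_iso :
  PL_iso (@flag R P (comparability (Pp :\ z)))
         (@flag R P (star (comparability Pp) z)).
Proof.
apply: PL_iso_trans weldedQ.
apply: PL_iso_trans (flag_eq R (fun u v => esym (welded_set0 u v))) _.
apply: (upset_ind (S := fun U => PL_iso (flag (welded U)) (flag (welded Q)))).
  exact: flag_eq.
move=> U y UQ yQ yU up ymax; apply: PL_iso_trans; apply: PL_iso_sym.
exact: welded_step.
Qed.

End ZeroX.

End Moves.

Lemma twin_proper {disp : Order.disp_t} {P : finTBPOrderType disp}
    (x z c : P) tau : twin x z c tau -> z \in proper_part P.
Proof.
move=> T; have [xz xc] := (twin_xz T, twin_xc T).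
rewrite !inE negb_or (gt_eqF (le_lt_trans (le0x x) xz)) /=.
apply/eqP => zt; have : (tau c <= tau x)%O by rewrite (twin_x T) zt lex1.
by rewrite (twin_mono T) ?lexx ?(ltW xc) // lt_geF.
Qed.

Lemma link_free_face {disp : Order.disp_t} {P : finTBPOrderType disp}
    (x z c : P) tau : twin x z c tau -> x != \bot%O ->
  free_face (link (comparability (proper_part P)) z).
Proof.
move=> T x0; set e := link _ _; have xz := twin_xz T.
have xP : x \in proper_part P.
  by rewrite !inE negb_or x0 (lt_eqF (lt_le_trans xz (lex1 z))).
pose ok s := clique e s && (x \notin s).
have ok0 : ok set0.
  by rewrite /ok inE andbT; apply/cliqueP => u v; rewrite inE.
(* A clique avoiding [x] of maximal size: nothing other than [x] can extend it. *)
have [s /andP[/cliqueP cl xs] smax] := @arg_maxnP _ set0 ok (fun s => #|s|) ok0.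
have e_sym : symmetric e by apply/link_sym/comparability_sym.
have xe u : e u u -> e u x.
  move=> /and5P[/and3P[uP _ _] /and3P[_ zP uz] _ uz' _].
  rewrite /e /link /comparability uP xP zP uz uz' (le_comparable (ltW xz)).
  rewrite (lt_eqF xz) !andbT /=; case/orP: uz => [uz|zu].
    by apply: le_comparable; apply: twin_below T _ _; rewrite lt_neqAle uz' uz.
  by rewrite comparable_sym le_comparable // (le_trans (ltW xz)).
have exx : e x x.
  rewrite /e /link /comparability xP comparablexx (lt_eqF xz).
  by rewrite (le_comparable (ltW xz)) (twin_proper T).
exists s, x; split=> //.
  apply/cliqueP => u v; rewrite !inE => /predU1P[->|us] /predU1P[->|vs] //.
  - by rewrite e_sym; apply: xe (cl _ _ vs vs).
  - exact: xe (cl _ _ us us).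
  - exact: cl _ _ us vs.
move=> u eu us ue; have [//|ux] := eqVneq u x.
have : ok (u |: s).
  apply/andP; split; last by rewrite !inE negb_or eq_sym ux.
  apply/cliqueP => v w.
  rewrite !inE => /predU1P[->|vs] /predU1P[->|ws] //.
  - exact: ue.
  - by rewrite e_sym ue.
  - exact: cl _ _ vs ws.
by move=> /smax /=; rewrite cardsU1 us add1n ltnn.
Qed.

Theorem theorem4p7 (R : realType) (disp : Order.disp_t)
    (P : finTBPOrderType disp) (z : P) (d : nat) :
  removable z ->
  PL_ball R d (order_complex (proper_part P)) \/
  PL_sphere R d (order_complex (proper_part P)) ->
  PL_ball R d (order_complex (proper_part P :\ z)).
Proof.
move=> /removable_twin[x [c [tau T]]] ball_or_sphere.
have iso : PL_iso (@flag R P (comparability (proper_part P))) (@std R 'I_d.+1) \/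
    PL_iso (@flag R P (comparability (proper_part P))) (@std_boundary R 'I_d.+2).
  case: ball_or_sphere => /PL_homeomorphicE iso; [left|right]; move: iso.
    by apply: PL_iso_ext => y; [apply: realization_order_complex|apply: realization_simplex].
  by apply: PL_iso_ext => y; [apply: realization_order_complex|apply: realization_boundary].
have e_sym := comparability_sym (proper_part P).
have ezz : comparability (proper_part P) z z.
  by rewrite /comparability (twin_proper T) comparablexx.
suff : PL_iso (@flag R P (comparability (proper_part P :\ z))) (@std R 'I_d.+1).
  move=> iso'; apply/PL_homeomorphicE; move: iso'; apply: PL_iso_ext => y; split=> H.
  - exact/realization_order_complex.
  - exact/realization_order_complex.
  - exact/realization_simplex.
  - exact/realization_simplex.
have [x0|x0] := eqVneq x \bot%O.
  by apply: PL_iso_trans (remove_star_iso R T x0) (star_ball e_sym ezz iso).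
apply: PL_iso_trans (remove_iso R T x0) _; case: iso => // /sphere_link_not_free H.
by case: (H z e_sym ezz); apply: link_free_face T x0.
Qed.
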